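(* Let $K$ be a compact Hausdorff space, $\phi:K\to K$ a continuous map and $t\in K$. Then the one point w*-semicrossed product $\mathcal{C}_t\subseteq\mathcal{B}(\ell^2(\mathbb{Z}_+))$ is reflexive.
   Context: Let $\mathbb{Z}_+=\{0,1,2,\dots\}$, $(e_n)_{n\ge0}$ the standard basis of $\ell^2(\mathbb{Z}_+)$, $p_n$ the projection onto $\mathbb{C}e_n$, $v$ the unilateral shift $ve_n=e_{n+1}$. For $f\in C(K)$ let $\pi_t(f)=\sum_{n\ge0}f(\phi^n(t))p_n\in\mathcal{B}(\ell^2(\mathbb{Z}_+))$. The one point w*-semicrossed product $\mathcal{C}_t$ is the w*-closed linear span in $\mathcal{B}(\ell^2(\mathbb{Z}_+))$ of the `analytic polynomials' $\sum_{n=0}^kv^n\pi_t(f_n)$, $f_n\in C(K)$, $k\ge0$. A subspace $\mathcal{S}\subseteq\mathcal{B}(L)$, $L$ a Hilbert space, is reflexive if it equals $\mathrm{Ref}(\mathcal{S})=\{T\in\mathcal{B}(L):T\xi\in\overline{\mathcal{S}\xi}\text{ for all }\xi\in L\}$. *)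

(* Defs.v *)
From HB Require Import structures.
From mathcomp Require Import all_boot all_order all_algebra.
From mathcomp Require Import all_classical all_reals all_analysis.
From mathcomp Require Import complex.

Set Implicit Arguments.
Unset Strict Implicit.
Unset Printing Implicit Defensive.

Import Order.TTheory GRing.Theory Num.Theory.
Import numFieldNormedType.Exports.
Import ComplexField.Normc.

Local Open Scope classical_set_scope.
Local Open Scope ring_scope.

Section BoundedOperators.
Context {K : numFieldType} (V : normedModType K).

Definition bounded_op : {pred (V -> V)} := fun T =>
  `[< (forall a x y, T (a *: x + y) = a *: T x + T y) /\
      exists M : K, forall x, `|T x| <= M * `|x| >].

Lemma bounded_opP (T : V -> V) :
  reflect ((forall a x y, T (a *: x + y) = a *: T x + T y) /\
      exists M : K, 0 <= M /\ forall x, `|T x| <= M * `|x|)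
    (T \in bounded_op).
Proof.
apply: (iffP (asboolP _)) => -[Tl [M]].
  move=> TM; split=> //.
  have [[x x0]|] := pselect (exists x : V, x != 0).
    exists M; split=> //; have := le_trans (normr_ge0 _) (TM x).
    by rewrite pmulr_lge0// normr_gt0.
  move=> V0; exists 0; split=> // x.
  have -> : x = 0.
    by apply: contra_notP V0 => /eqP x0; exists x.
  by have := TM 0; rewrite normr0 !mulr0.
by case=> _ TM; split=> //; exists M.
Qed.

Lemma bounded_op_closed : submod_closed bounded_op.
Proof.
split.
  apply/bounded_opP; split=> [a x y|]; first by rewrite scaler0 addr0.
  by exists 0; split=> // x; rewrite normr0 mul0r.
move=> c S T /bounded_opP[Sl [M [M0 SM]]] /bounded_opP[Tl [N [N0 TN]]].
apply/bounded_opP; split=> [a x y|].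
  rewrite !fctE /= Sl Tl !scalerDr !scalerA (mulrC c a) -!addrA; congr (_ + _).
  by rewrite addrCA.
exists (`|c| * M + N); split; first by rewrite addr_ge0// mulr_ge0.
move=> x; rewrite !fctE (le_trans (ler_normD _ _))// mulrDl lerD//.
by rewrite normrZ -mulrA ler_wpM2l.
Qed.

HB.instance Definition _ :=
  GRing.isSubmodClosed.Build K (V -> V) bounded_op bounded_op_closed.

Record bop := Bop { bop_fun :> V -> V; bop_funP : bop_fun \in bounded_op }.

HB.instance Definition _ := [isSub for bop_fun].
HB.instance Definition _ := [Choice of bop by <:].
HB.instance Definition _ := [SubChoice_isSubLmodule of bop by <:].

Lemma bopL (T : bop) a x y : T (a *: x + y) = a *: T x + T y.
Proof. by have /bounded_opP[] := bop_funP T. Qed.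

HB.instance Definition _ (T : bop) :=
  GRing.isLinear.Build K V V *:%R (bop_fun T) (bopL T).

Lemma bopP (S T : bop) : S =1 T -> S = T.
Proof. by move=> ST; apply/val_inj/funext. Qed.

Lemma bop1_subproof : idfun \in bounded_op.
Proof. by apply/bounded_opP; split=> //; exists 1; split=> // x; rewrite mul1r. Qed.

Definition bop1 : bop := Bop bop1_subproof.

Lemma bopM_subproof (S T : bop) : S \o T \in bounded_op.
Proof.
have /bounded_opP[_ [M [M0 SM]]] := bop_funP S.
have /bounded_opP[_ [N [N0 TN]]] := bop_funP T.
apply/bounded_opP; split=> [a x y|/=]; first by rewrite /= !linearP.
exists (M * N); split; first exact: mulr_ge0.
by move=> x; rewrite (le_trans (SM _))// -mulrA ler_wpM2l.
Qed.

Definition bopM (S T : bop) : bop := Bop (bopM_subproof S T).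

Fact bopMA : associative bopM. Proof. by move=> S T U; exact: bopP. Qed.
Fact bop1M : left_id bop1 bopM. Proof. by move=> T; exact: bopP. Qed.
Fact bopM1 : right_id bop1 bopM. Proof. by move=> T; exact: bopP. Qed.
Fact bopMDl : left_distributive bopM +%R.
Proof. by move=> S T U; exact: bopP. Qed.
Fact bopMDr : right_distributive bopM +%R.
Proof. by move=> S T U; apply: bopP => x; exact: linearD. Qed.

(* The product is composition: this makes [S * T] and [T ^+ n] available. *)
HB.instance Definition _ :=
  GRing.Zmodule_isPzRing.Build bop bopMA bop1M bopM1 bopMDl bopMDr.

Implicit Type S : set bop.

Definition lspan S : set bop :=
  [set T | exists n (a : 'I_n -> K) (A : 'I_n -> bop),
     (forall i, S (A i)) /\ T = \sum_(i < n) a i *: A i].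

Definition Ref S : set bop :=
  [set T | forall xi : V, closure [set (A : bop) xi | A in S] (T xi)].

Definition reflexive_space S : Prop := S = Ref S.

End BoundedOperators.

Arguments bounded_op {K V}.

(* R[i] with its norm topology, as a normed space over itself. *)
HB.instance Definition _ (R : rcfType) := NormedModule.copy R[i] R[i]^o.

Section Ell2.
Variable R : realType.
Local Notation C := R[i].

Definition sq_series (x : nat -> C) : nat -> R :=
  [series normc (x n) ^+ 2]_n.

Definition sqsum : {pred nat -> C} := fun x => `[< cvgn (sq_series x) >].

Lemma minkowski2 (a b : nat -> R) n :
  Num.sqrt (\sum_(0 <= k < n) (a k + b k) ^+ 2) <=
  Num.sqrt (\sum_(0 <= k < n) a k ^+ 2) + Num.sqrt (\sum_(0 <= k < n) b k ^+ 2).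
Proof.
elim: n => [|n IH]; first by rewrite !big_nil sqrtr0 addr0.
rewrite !big_nat_recr//=.
set s := \sum_(0 <= _ < _) _ in IH *.
set t := \sum_(0 <= _ < _) _ in IH *.
set u := \sum_(0 <= _ < _) _ in IH *.
have s0 : 0 <= s by apply: sumr_ge0 => *; exact: sqr_ge0.
have t0 : 0 <= t by apply: sumr_ge0 => *; exact: sqr_ge0.
have u0 : 0 <= u by apply: sumr_ge0 => *; exact: sqr_ge0.
have := le_normcD (Complex (Num.sqrt t) (a n)) (Complex (Num.sqrt u) (b n)).
rewrite /= !sqr_sqrtr//; apply: le_trans; rewrite ler_wsqrtr// lerD2r.
by rewrite -[leLHS]sqr_sqrtr// ler_sqr ?nnegrE ?addr_ge0 ?sqrtr_ge0.
Qed.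

Definition l2norm (x : nat -> C) : R := Num.sqrt (limn (sq_series x)).

Lemma sq_series_ge0 x n : 0 <= sq_series x n.
Proof. by apply: sumr_ge0 => k _; exact: sqr_ge0. Qed.

Lemma nondecreasing_sq_series x : nondecreasing_seq (sq_series x).
Proof. by apply: nondecreasing_series => n _ _; exact: sqr_ge0. Qed.

Lemma sqsum_bound (x : nat -> C) (M : R) :
  (forall n, sq_series x n <= M) -> x \in sqsum /\ limn (sq_series x) <= M.
Proof.
move=> xM; have cx : cvgn (sq_series x).
  apply: nondecreasing_is_cvgn; first exact: nondecreasing_sq_series.
  by exists M => _ [n _ <-].
by split; [exact/asboolP | apply: limr_le => //; exact: nearW].
Qed.

Lemma sq_series_le x : x \in sqsum -> forall n, sq_series x n <= limn (sq_series x).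
Proof.
move=> /asboolP cx n.
by apply: nondecreasing_cvgn_le => //; exact: nondecreasing_sq_series.
Qed.

Lemma sq_series_le_l2norm x : x \in sqsum ->
  forall n, Num.sqrt (sq_series x n) <= l2norm x.
Proof. by move=> xs n; rewrite ler_wsqrtr// sq_series_le. Qed.

Lemma sqsum_l2norm_bound (x : nat -> C) (M : R) : 0 <= M ->
  (forall n, sq_series x n <= M ^+ 2) -> x \in sqsum /\ l2norm x <= M.
Proof.
move=> M0 /sqsum_bound[xs xM]; split=> //.
by rewrite -[leRHS]ger0_norm// -sqrtr_sqr ler_wsqrtr.
Qed.

Lemma l2normD x y : x \in sqsum -> y \in sqsum ->
  (x + y \in sqsum) /\ l2norm (x + y) <= l2norm x + l2norm y.
Proof.
move=> xs ys; apply: sqsum_l2norm_bound; first by rewrite addr_ge0 ?sqrtr_ge0.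
move=> n; rewrite -[leLHS]sqr_sqrtr ?sq_series_ge0//.
rewrite ler_sqr ?nnegrE ?addr_ge0 ?sqrtr_ge0//.
apply: (@le_trans _ _ (Num.sqrt (sq_series x n) + Num.sqrt (sq_series y n))).
  rewrite /sq_series /series/=.
  apply: le_trans (minkowski2 (fun k => normc (x k)) (fun k => normc (y k)) n).
  rewrite ler_wsqrtr// ler_sum// => k _.
  rewrite ler_sqr ?nnegrE ?addr_ge0 ?(@normr_ge0 _ (Rcomplex R))//.
  exact: le_normcD.
by rewrite lerD// sq_series_le_l2norm.
Qed.

Lemma l2norm_mul (a x : nat -> C) (M : R) : 0 <= M ->
  (forall n, normc (a n) <= M) -> x \in sqsum ->
  ((fun n => a n * x n) \in sqsum) /\ l2norm (fun n => a n * x n) <= M * l2norm x.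
Proof.
move=> M0 aM xs; apply: sqsum_l2norm_bound; first by rewrite mulr_ge0 ?sqrtr_ge0.
move=> n; apply: (@le_trans _ _ (M ^+ 2 * sq_series x n)).
  rewrite /sq_series /series /= mulr_sumr ler_sum// => k _.
  rewrite normcM exprMn ler_wpM2r ?sqr_ge0// ler_sqr ?nnegrE//.
  exact: (@normr_ge0 _ (Rcomplex R)).
rewrite exprMn ler_wpM2l ?sqr_ge0// sqr_sqrtr; first exact: sq_series_le.
exact: le_trans (sq_series_ge0 x 0) (sq_series_le xs 0%N).
Qed.

Lemma l2norm0 : ((0 : nat -> C) \in sqsum) /\ l2norm 0 = 0.
Proof.
have [] := @sqsum_l2norm_bound 0 0 (lexx _).
  move=> n; rewrite expr0n/= /sq_series /series/= big1// => k _.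
  by rewrite [X in X ^+ 2](@normc0 R) expr0n.
by move=> ? ?; split=> //; apply/eqP; rewrite eq_le sqrtr_ge0 andbT.
Qed.

Lemma sqsum_closed : submod_closed sqsum.
Proof.
split=> [|a x y xs ys]; first by have [] := l2norm0.
apply: (l2normD _ ys).1.
exact: (@l2norm_mul (cst a) x (normc a) (@normr_ge0 _ (Rcomplex R) a) _ xs).1.
Qed.

HB.instance Definition _ :=
  GRing.isSubmodClosed.Build C (nat -> C) sqsum sqsum_closed.

Record ell2 := Ell2 { ell2_val :> nat -> C; ell2P : ell2_val \in sqsum }.

HB.instance Definition _ := [isSub for ell2_val].
HB.instance Definition _ := [Choice of ell2 by <:].
HB.instance Definition _ := [SubChoice_isSubLmodule of ell2 by <:].

Definition ell2_norm (x : ell2) : C := ((l2norm x)%:C)%C.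

Lemma ell2_normD x y : ell2_norm (x + y) <= ell2_norm x + ell2_norm y.
Proof. by rewrite -rmorphD lecR (l2normD (ell2P x) (ell2P y)).2. Qed.

Lemma l2normZ_le a (x : ell2) : l2norm (a *: x) <= normc a * l2norm x.
Proof.
exact: (@l2norm_mul (cst a) x (normc a) (@normr_ge0 _ (Rcomplex R) a) _ (ell2P x)).2.
Qed.

Lemma ell2_normZ a x : ell2_norm (a *: x) = `|a| * ell2_norm x.
Proof.
rewrite -[`|a|]/(((normc a)%:C)%C) -rmorphM; congr (_%:C)%C.
have [->|a0] := eqVneq a 0.
  by rewrite scale0r normc0 mul0r l2norm0.2.
apply/eqP; rewrite eq_le l2normZ_le/=.
have na0 : 0 < normc a.
  by rewrite (@normr_gt0 _ (Rcomplex R)).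
rewrite -ler_pdivlMl// -normcV -[in leLHS](scalerK a0 x).
exact: l2normZ_le.
Qed.

Lemma ell2_norm_eq0 x : ell2_norm x = 0 -> x = 0.
Proof.
move=> [] /eqP; rewrite sqrtr_eq0 => x0; apply/val_inj/funext => n.
have := le_trans (sq_series_le (ell2P x) n.+1) x0.
rewrite /sq_series /series/= big_nat_recr//= => h.
have {}h : normc (x n) ^+ 2 <= 0.
  by apply: le_trans h; rewrite lerDr; exact: sq_series_ge0.
apply: eq0_normc; apply/eqP; rewrite -sqrf_eq0 eq_le h; exact: sqr_ge0.
Qed.

HB.instance Definition _ := Lmodule_isNormed.Build C ell2
  ell2_normD ell2_normZ ell2_norm_eq0.

(* The limit exists by Cauchy-Schwarz and completeness of R[i]. *)
Definition ell2_dot (x y : ell2) : C :=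
  limn [series x n * ((y n)^*)%C]_n.

Lemma ell2_dotxx (x : ell2) : ell2_dot x x = `|x| ^+ 2.
Proof.
apply: (@cvg_lim C); first exact: norm_hausdorff.
rewrite -[`|x|]/((l2norm x)%:C)%C -rmorphXn sqr_sqrtr; last first.
  exact: le_trans (sq_series_ge0 x 0) (sq_series_le (ell2P x) 0%N).
have -> : [series x n * ((x n)^*)%C]_n = (fun n => ((sq_series x n)%:C)%C).
  apply/funext => n; rewrite /sq_series /series/= rmorph_sum.
  by apply: eq_bigr => k _; rewrite rmorphXn -sqr_normc.
apply/(@cvgrPdist_lt C C) => -[e e']; rewrite ltcE/= => /andP[/eqP -> e0].
have /cvgrPdist_lt/(_ e e0) : sq_series x @ \oo --> limn (sq_series x).
  exact/asboolP/ell2P.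
apply: filterS => n xn; rewrite -rmorphB normc_def/= expr0n addr0 sqrtr_sqr.
by rewrite ltcR.
Qed.

Definition square_summable (xi : nat -> ell2) : Prop :=
  cvgn [series l2norm (xi k) ^+ 2]_k.

(* By the trace duality, the functionals T |-> sum_k <T xi_k, eta_k> with     *)
(* sum_k |xi_k|^2 and sum_k |eta_k|^2 finite are exactly the w*-continuous    *)
(* ones (the predual of B(ell2)); the w*-topology is the initial topology of  *)
(* this family.                                                               *)
Definition wstar_index : Type := {p : (nat -> ell2) * (nat -> ell2) |
  square_summable p.1 /\ square_summable p.2}.

Definition wstar_eval (T : bop ell2) : {ptws wstar_index -> C} := fun p =>
  limn [series ell2_dot (T ((sval p).1 k)) ((sval p).2 k)]_k.

Definition wstar_closure (S : set (bop ell2)) : set (bop ell2) :=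
  closure (S : set (initial_topology wstar_eval)).

Lemma normc_le_l2norm (x : ell2) n : normc (x n) <= l2norm x.
Proof.
apply: le_trans (sq_series_le_l2norm (ell2P x) n.+1).
rewrite /sq_series /series/= big_nat_recr//=.
rewrite -[leLHS](ger0_norm (@normr_ge0 _ (Rcomplex R) (x n))) -sqrtr_sqr.
by rewrite ler_wsqrtr// lerDr; exact: sq_series_ge0.
Qed.

Lemma ell2_basis_subproof n : (fun k => (k == n)%:R : C) \in sqsum.
Proof.
apply: (@sqsum_bound _ 1 _).1 => m.
rewrite /sq_series /series/=.
have -> : \sum_(0 <= k < m) normc ((k == n)%:R : C) ^+ 2 = (n < m)%:R.
  elim: m => [|m IH]; first by rewrite big_nil.
  rewrite big_nat_recr//= IH [in RHS]ltnS [in RHS]leq_eqVlt eq_sym.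
  have [->|mn] := eqVneq n m.
    by rewrite ltnn [X in X ^+ 2](@normc1 R) expr1n add0r.
  by rewrite [X in X ^+ 2](@normc0 R) expr0n/= addr0.
by rewrite lern1 leq_b1.
Qed.

Definition ell2_basis n : ell2 := Ell2 (ell2_basis_subproof n).

Lemma ell2_basis_expansion (x : ell2) : [series x n *: ell2_basis n]_n @ \oo --> x.
Proof.
set u := [series _]_n.
have uE n k : u n k = if (k < n)%N then x k else 0.
  rewrite /u /series/=; elim: n => [|n IH]; first by rewrite big_nil.
  rewrite big_nat_recr//= [LHS](_ : _ = u n k + x n * (k == n)%:R)//.
  rewrite [u n k]IH ltnS [in RHS]leq_eqVlt.
  have [->|kn] := eqVneq k n; first by rewrite ltnn add0r mulr1.
  by rewrite mulr0 addr0.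
have dist n : l2norm (x - u n) ^+ 2 <= limn (sq_series x) - sq_series x n.
  have zE k : (x - u n) k = if (k < n)%N then 0 else x k.
    rewrite [LHS](_ : _ = x k - u n k)// uE.
    by case: ifP; rewrite ?subrr ?subr0.
  have zle m : sq_series (x - u n) m <= limn (sq_series x) - sq_series x n.
    rewrite lerBrDr.
    apply: le_trans (sq_series_le (ell2P x) (n + m)%N).
    apply: (@le_trans _ _ (sq_series (x - u n) (n + m) + sq_series x n)).
      by rewrite lerD2r nondecreasing_sq_series// leq_addl.
    rewrite /sq_series /series/= (@big_cat_nat _ _ _ n)//= ?leq_addr//.
    rewrite (@big_cat_nat _ _ _ n 0%N (n + m)%N _ (fun k => normc (x k) ^+ 2))//= ?leq_addr//.
    rewrite big_nat big1 ?add0r; last first.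
      by move=> k /andP[_ kn]; rewrite [X in normc X]zE kn [X in X ^+ 2](@normc0 R) expr0n.
    rewrite [leRHS]addrC lerD2r big_nat [leRHS]big_nat ler_sum// => k /andP[nk _].
    by rewrite [X in normc X]zE ltnNge nk.
  have [_ zb] := sqsum_bound zle.
  rewrite sqr_sqrtr//.
  exact: le_trans (sq_series_ge0 (x - u n) 0) (sq_series_le (ell2P _) 0%N).
apply/cvgrPdist_lt => -[e e']; rewrite ltcE/= => /andP[/eqP -> e0].
have /cvgrPdist_lt/(_ (e ^+ 2)) : sq_series x @ \oo --> limn (sq_series x).
  exact/asboolP/ell2P.
rewrite exprn_gt0// => /(_ isT); apply: filterS => n xn.
change ((l2norm (x - u n))%:C%C < e%:C%C); rewrite ltcR.
rewrite -ltr_sqr ?nnegrE ?sqrtr_ge0 ?(ltW e0)//.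
exact: le_lt_trans (dist n) (le_lt_trans (ler_norm _) xn).
Qed.

Lemma basis_proj_subproof n : (fun x : ell2 => x n *: ell2_basis n) \in bounded_op.
Proof.
apply/bounded_opP; split=> [a x y|]; first by rewrite scalerDl scalerA.
exists `|ell2_basis n|; split=> // x.
by rewrite normrZ mulrC ler_wpM2l// lecR normc_le_l2norm.
Qed.

Definition basis_proj n : bop ell2 := Bop (basis_proj_subproof n).

Definition ushift_seq (x : nat -> C) (n : nat) : C :=
  if n is m.+1 then x m else 0.

Lemma sq_series_ushift x n : sq_series (ushift_seq x) n.+1 = sq_series x n.
Proof.
by rewrite /sq_series /series/= big_nat_recl//= [X in X ^+ 2](@normc0 R) expr0n add0r.
Qed.

Lemma ushift_seqP (x : ell2) :
  ushift_seq x \in sqsum /\ l2norm (ushift_seq x) <= l2norm x.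
Proof.
apply: sqsum_l2norm_bound; first exact: sqrtr_ge0.
case=> [|n]; first by rewrite /sq_series /series/= big_nil sqr_ge0.
rewrite sq_series_ushift sqr_sqrtr; first exact/sq_series_le/ell2P.
exact: le_trans (sq_series_ge0 x 0) (sq_series_le (ell2P x) 0%N).
Qed.

Lemma ushift_subproof : (fun x => Ell2 (ushift_seqP x).1) \in bounded_op.
Proof.
apply/bounded_opP; split=> [a x y|].
  by apply/val_inj/funext => -[|n] //=; rewrite /= !fctE/= scaler0 addr0.
by exists 1; split=> // x; rewrite mul1r lecR (ushift_seqP x).2.
Qed.

Definition ushift : bop ell2 := Bop ushift_subproof.

Lemma ushift_ell2_basis n : ushift (ell2_basis n) = ell2_basis n.+1.
Proof. by apply/val_inj/funext => -[|k]. Qed.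

Lemma normc_continuous : continuous (@normc R : C -> R).
Proof.
move=> x; apply/(@cvgrPdist_lt R R^o C (nbhs x) (nbhs_filter x)) => e e0.
have ee0 : 0 < (e%:C)%C by rewrite ltcR.
have := @cvgr_dist_lt C C C (nbhs x) _ id x (fun _ => id) _ ee0.
move=> /(_ (nbhs_filter x)) h.
apply: (@filterS C (nbhs x) (nbhs_filter x) _ _ _ h) => y xy.
have {}xy : normc (x - y) < e by rewrite -ltcR.
exact: le_lt_trans (@ler_dist_dist _ (Rcomplex R) x y) xy.
Qed.

Section Semicrossed.
Variables (K : topologicalType) (cK : compact [set: K]) (phi : K -> K) (t : K).

Lemma bounded_on_compact (f : continuousType K C) :
  exists M : R, 0 <= M /\ forall s, normc (f s) <= M.
Proof.
have [||c _ cmax] := @compact_EVT_max K R (fun s => normc (f s)) setT _ cK.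
- by exists t.
- apply/continuous_subspaceT => s.
  apply: (@continuous_comp _ _ _ f (@normc R : C -> R)).
    exact: cts_fun.
  exact: normc_continuous.
exists (normc (f c)); split; first exact: (@normr_ge0 _ (Rcomplex R)).
by move=> s; apply: cmax; rewrite inE.
Qed.

Lemma orbit_rep_seqP (f : continuousType K C) (x : ell2) :
  (fun n => f (iter n phi t) * x n) \in sqsum.
Proof.
have [M [M0 fM]] := bounded_on_compact f.
exact: (@l2norm_mul (fun n => f (iter n phi t)) x M M0 _ (ell2P x)).1.
Qed.

Lemma orbit_rep_subproof f : (fun x => Ell2 (orbit_rep_seqP f x)) \in bounded_op.
Proof.
apply/bounded_opP; split=> [a x y|].
  apply/val_inj/funext => n; rewrite /= !fctE/= mulrDr; congr (_ + _).
  exact: mulrCA.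
have [M [M0 fM]] := bounded_on_compact f.
exists (M%:C)%C; split=> [|x]; first by rewrite lecR.
rewrite -[`|x|]/((l2norm x)%:C)%C -rmorphM lecR.
exact: (@l2norm_mul (fun n => f (iter n phi t)) x M M0 _ (ell2P x)).2.
Qed.

(* pi_t(f), the diagonal operator with entries f (phi^n t); it is the         *)
(* strongly convergent sum of the f (phi^n t) p_n by [orbit_rep_series].      *)
Definition orbit_rep (f : continuousType K C) : bop ell2 := Bop (orbit_rep_subproof f).

Lemma orbit_rep_series (f : continuousType K C) (x : ell2) :
  [series f (iter n phi t) *: basis_proj n x]_n @ \oo --> orbit_rep f x.
Proof.
have := @ell2_basis_expansion (orbit_rep f x).
by under eq_fun do rewrite /= -scalerA.
Qed.

Definition analytic_polynomials : set (bop ell2) :=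
  [set T | exists k (f : 'I_k.+1 -> continuousType K C),
     T = \sum_(n < k.+1) ushift ^+ n * orbit_rep (f n)].

Definition semicrossed_product : set (bop ell2) :=
  wstar_closure (lspan analytic_polynomials).

End Semicrossed.

End Ell2.

(* Main.v *)
(* T is said to be orbit-Toeplitz when it is lower triangular and each of its
   diagonals m |-> <T e_m, e_(m+n)> is a function of the orbit point phi^m t;
   both Ref(C_t) and C_t coincide with the set of such operators.

   These conditions are w*-closed and hold for analytic polynomials.  They also
   pass to Ref(C_t): if phi^(j+p) t = phi^j t and y_l = (1, l, l^2, ...) with
   0 < l <= 1/2, every A in C_t satisfies A e_(j+p) = v^p A e_j, hence
   <A (e_(j+p) - l^p e_j), y_l> = 0; so the same holds for T in Ref(C_t), i.e.
   the power series with coefficients T e_(j+p) - v^p T e_j vanishes at every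
   such l.

   Conversely the Cesaro means of an orbit-Toeplitz T are bounded by the norm
   of T and converge to it entrywise, hence w*.  Each of them is a finite sum of
   v^n b_n with b_n diagonal and constant on the fibres of m |-> phi^m t; by
   Tietze's theorem on finite pieces of the orbit it is the w*-limit of a
   bounded sequence of analytic polynomials. *)
From HB Require Import structures.
Require Import Defs.
From mathcomp Require Import all_boot all_order all_algebra.
From mathcomp Require Import all_classical all_reals all_analysis.
From mathcomp Require Import complex lra ring zify.

Set Implicit Arguments.
Unset Strict Implicit.
Unset Printing Implicit Defensive.

Import Order.TTheory GRing.Theory Num.Theory.
Import numFieldNormedType.Exports.
Import ComplexField.Normc.

Local Open Scope classical_set_scope.
Local Open Scope ring_scope.

(** * Series of complex numbers *)

Section ComplexSeries.
Variable R : realType.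
Local Notation C := R[i].

Lemma normc_ge0 (z : C) : 0 <= normc z.
Proof. exact: (@normr_ge0 _ (Rcomplex R)). Qed.

Lemma normcE (z : C) : `|z| = ((normc z)%:C)%C.
Proof. by case: z. Qed.

Lemma normc_real (r : R) : normc (r%:C)%C = `|r|.
Proof. by rewrite /= expr0n addr0 sqrtr_sqr. Qed.

Lemma complex_cvgP (u : nat -> C) (l : C) :
  u @ \oo --> l <-> (fun n => normc (l - u n)) @ \oo --> (0 : R).
Proof.
split.
  move=> ul; apply/(@cvgrPdist_lt R R^o) => e e0.
  have ee0 : 0 < (e%:C)%C by rewrite ltcR.
  have /cvgrPdist_lt/(_ _ ee0) := ul.
  apply: filterS => n.
  by rewrite normcE ltcR sub0r normrN ger0_norm// normc_ge0.
move=> ul; apply/(@cvgrPdist_lt C C) => -[e e'].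
rewrite ltcE/= => /andP[/eqP -> e0].
have /cvgrPdist_lt/(_ _ e0) := ul.
apply: filterS => n.
by rewrite normcE ltcR sub0r normrN ger0_norm// normc_ge0.
Qed.

Lemma complex_cvg_lim (u : nat -> C) (l : C) : u @ \oo --> l -> limn u = l.
Proof. by move=> ul; apply: (@cvg_lim C) => //; exact: norm_hausdorff. Qed.

Lemma complex_cvgD (u v : nat -> C) (l m : C) :
  u @ \oo --> l -> v @ \oo --> m -> (fun n => u n + v n) @ \oo --> l + m.
Proof. exact: (@cvgD C C). Qed.

Lemma complex_cvgZ (c : C) (u : nat -> C) (l : C) :
  u @ \oo --> l -> (fun n => c * u n) @ \oo --> c * l.
Proof. exact: (@cvgMr C). Qed.

Lemma cvg0_le (u v : nat -> R) : (forall n, 0 <= u n <= v n) ->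
  v @ \oo --> 0 -> u @ \oo --> 0.
Proof.
move=> uv v0; apply: (@squeeze_cvgr _ _ _ _ (cst 0) v) => //.
  by apply: nearW => n; exact: uv.
exact: cvg_cst.
Qed.

Lemma normc_lim_le (u : nat -> C) (l : C) (M : R) :
  u @ \oo --> l -> (forall n, normc (u n) <= M) -> normc l <= M.
Proof.
move=> /complex_cvgP ul uM; apply/ler_addgt0Pr => e e0.
have /cvgrPdist_lt/(_ _ e0)[N _ /(_ N (leqnn N))] := ul.
rewrite /= sub0r normrN ger0_norm ?normc_ge0// => le.
rewrite -[l](subrK (u N)) (le_trans (le_normcD _ _))// addrC lerD//.
exact: ltW.
Qed.

Lemma real_complex_cvg (u : nat -> R) (l : R) :
  u @ \oo --> l -> (fun n => ((u n)%:C)%C) @ \oo --> (l%:C)%C.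
Proof.
move=> ul; apply/complex_cvgP; under eq_fun do rewrite -rmorphB.
under eq_fun do rewrite normc_real.
by apply/norm_cvg0P; rewrite -[0](subrr l); apply: cvgB => //; exact: cvg_cst.
Qed.

Lemma normc_le_ReIm (a b : R) : normc (Complex a b) <= `|a| + `|b|.
Proof.
rewrite /= -[leRHS]ger0_norm ?addr_ge0// -sqrtr_sqr ler_wsqrtr//.
rewrite sqrrD !real_normK ?num_real// lerD2r lerDl.
by rewrite mulrn_wge0// mulr_ge0.
Qed.

Lemma Re_le_normc (z : C) : `|complex.Re z| <= normc z.
Proof. by case: z => a b /=; rewrite -sqrtr_sqr ler_wsqrtr// lerDl sqr_ge0. Qed.

Lemma Im_le_normc (z : C) : `|complex.Im z| <= normc z.
Proof. by case: z => a b /=; rewrite -sqrtr_sqr ler_wsqrtr// lerDr sqr_ge0. Qed.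

Lemma nneg_series_cvg (u : nat -> R) (M : R) : (forall n, 0 <= u n) ->
  (forall n, \sum_(0 <= k < n) u k <= M) -> cvgn (series u).
Proof.
move=> u0 uM; apply: nondecreasing_is_cvgn.
  by apply: nondecreasing_series => n _ _; exact: u0.
by exists M => _ [n _ <-]; exact: uM.
Qed.

(** Absolute convergence is transferred to the real and imaginary parts, both dominated by the
    modulus; their limits are reassembled into a complex one, and the triangle inequality on partial
    sums gives the bound. *)
Lemma complex_series_bound (u : nat -> C) (M : R) :
  (forall n, \sum_(0 <= k < n) normc (u k) <= M) ->
  cvgn (series u) /\ normc (limn (series u)) <= M.
Proof.
move=> uM.
have part (p : C -> R) : (forall z, `|p z| <= normc z) ->
    cvgn [series p (u k)]_k.
  move=> pz; apply: normed_cvg; apply: (@nneg_series_cvg _ M) => n.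
    exact: normr_ge0.
  by apply: le_trans (uM n); apply: ler_sum => k _; exact: pz.
have cRe := part _ Re_le_normc; have cIm := part _ Im_le_normc.
have seriesE n : series u n =
    Complex ([series complex.Re (u k)]_k n) ([series complex.Im (u k)]_k n).
  rewrite /series/=; elim: n => [|n IH]; first by rewrite !big_nil.
  by rewrite !big_nat_recr//= IH; case: (u n).
have cu : series u @ \oo -->
    Complex (limn [series complex.Re (u k)]_k)
            (limn [series complex.Im (u k)]_k).
  apply/complex_cvgP; apply: cvg0_le.
    move=> n; rewrite normc_ge0 seriesE; exact: normc_le_ReIm.
  have dist (v : nat -> R) : cvgn v -> (fun n => `|limn v - v n|) @ \oo --> 0.
    move=> cv; apply/norm_cvg0P; rewrite -[0](subrr (limn v)).
    by apply: cvgB => //; exact: cvg_cst.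
  by rewrite -(addr0 0); apply: cvgD; exact: dist.
split; first by apply/cvg_ex; eexists; exact: cu.
rewrite (complex_cvg_lim cu); apply: normc_lim_le cu _ => n.
apply: le_trans (uM n); rewrite /series/=.
elim/big_ind2 : _ => [|x a y b xa yb|k _]; rewrite ?normc0//.
exact: le_trans (le_normcD _ _) (lerD xa yb).
Qed.
End ComplexSeries.

(** * The w*-topology *)

Section WstarTopology.
Variable R : realType.
Local Notation C := R[i].
Local Notation B := (bop (ell2 R)).

Lemma wstar_eval_continuous p :
  continuous (fun T : initial_topology (@wstar_eval R) => wstar_eval T p).
Proof.
move=> T.
have cT : (fun A : initial_topology (@wstar_eval R) => wstar_eval A) @ T -->
    (wstar_eval T : {ptws wstar_index R -> C}).
  exact: initial_continuous.
apply: (cvg_comp _ (fun g : {ptws wstar_index R -> C} => g p) cT).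
(* The product topology is the supremum of the topologies pulled back along coordinates; [cvg_image]
   asks that the coordinate map be onto, which constant functions witness. *)
have /cvg_sup/(_ p)/cvg_image :
    (wstar_eval T : {ptws wstar_index R -> C}) --> wstar_eval T by exact: cvg_id.
move=> h; apply: cvg_trans (h _) => {h}.
  by move=> Q /= [W nbdW <-]; apply: filterS nbdW; exact: preimage_image.
rewrite eqEsubset; split => y // _; by exists (cst y).
Qed.

(** The initial topology is pulled back from a product, where convergence is coordinatewise. The
    terms need only lie in the closure, so approximations can be iterated: Cesaro means first, then
    analytic polynomials. *)
Lemma wstar_closure_cvg (S : set B) (A : nat -> B) (T : B) :
  (forall n, wstar_closure S (A n)) ->
  (forall p, (fun n => wstar_eval (A n) p) @ \oo --> wstar_eval T p) ->
  wstar_closure S T.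
Proof.
move=> SA AT.
apply: (@closed_cvg nat (initial_topology (@wstar_eval R)) \oo _ A
  (wstar_closure S)).
- exact: closed_closure.
- by apply: nearW => n; exact: SA.
have ptwsA : (fun n => wstar_eval (A n) : {ptws wstar_index R -> C}) @ \oo -->
    wstar_eval T.
  apply/cvg_sup => p; apply/cvg_image.
    by rewrite eqEsubset; split => y // _; exists (cst y).
  apply: cvg_trans (AT p) => W /= WA; exists (fun g => W (g p)) => //.
  by rewrite eqEsubset; split => [y [f ? <-]//|y Wy]; exists (cst y).
move=> W; rewrite nbhsE => -[U [[V oV VU] UT] UW]; subst U.
have /ptwsA : nbhs (wstar_eval T : {ptws wstar_index R -> C}) V.
  exact: open_nbhs_nbhs.
move=> AV; apply: (@filterS nat \oo _ (fun n => V (wstar_eval (A n)))) AV => n Vn.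
exact: UW.
Qed.

(** The coincidence set of two w*-continuous functionals is closed, as the preimage of 0 under their
    difference. This carries relations between matrix entries to the w*-closure. *)
Lemma wstar_closed_eval_eq (S : set B) p q :
  (forall A, S A -> wstar_eval A p = wstar_eval A q) ->
  forall T, wstar_closure S T -> wstar_eval T p = wstar_eval T q.
Proof.
move=> Spq T ST; apply: subr0_eq.
pose W := initial_topology (@wstar_eval R).
have cB : closed [set A : W | wstar_eval A p - wstar_eval A q = 0].
  apply: (@preimage_closed W C
    (fun A => wstar_eval A p - wstar_eval A q) [set 0]).
    by move=> A _; apply: (@continuousB _ C); exact: wstar_eval_continuous.
  exact/accessible_closed_set1/hausdorff_accessible/norm_hausdorff.
have /closure_id E := cB.
suff : [set A : W | wstar_eval A p - wstar_eval A q = 0] T by [].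
rewrite E; apply: closure_subset ST => A /Spq /= ->; exact: subrr.
Qed.

End WstarTopology.

(** * The inner product of ell2 and criteria for w*-convergence *)

Section Ell2Dot.
Variable R : realType.
Local Notation C := R[i].
Local Notation ell2 := (ell2 R).
Local Notation B := (bop ell2).

Lemma normc_conj (z : C) : normc (z^*)%C = normc z.
Proof. by case: z => a b /=; rewrite sqrrN. Qed.

Lemma l2norm_ge0 (x : nat -> C) : 0 <= l2norm x.
Proof. exact: sqrtr_ge0. Qed.

Lemma ell2_normE (x : ell2) : `|x| = ((l2norm x)%:C)%C.
Proof. by []. Qed.

Lemma ler_l2normD (x y : ell2) : l2norm (x + y : ell2) <= l2norm x + l2norm y.
Proof. exact: (l2normD (ell2P x) (ell2P y)).2. Qed.

Lemma bop_l2norm_bound (T : B) :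
  exists M : R, 0 <= M /\ forall x, l2norm (T x) <= M * l2norm x.
Proof.
have /bounded_opP[_ [[M M'] []]] := bop_funP T.
rewrite lecE/= => /andP[/eqP -> M0] TM; exists M; split=> // x.
by have := TM x; rewrite !ell2_normE -[Complex M 0]/((M%:C)%C) -rmorphM lecR.
Qed.

Lemma finite_cauchy_schwarz (a b : nat -> R) n :
  \sum_(0 <= k < n) a k * b k <=
  Num.sqrt (\sum_(0 <= k < n) a k ^+ 2) * Num.sqrt (\sum_(0 <= k < n) b k ^+ 2).
Proof.
elim: n => [|n IH]; first by rewrite !big_nil sqrtr0 mul0r.
rewrite !big_nat_recr//=.
set s := \sum_(0 <= _ < _) _ in IH *.
set t := \sum_(0 <= _ < _) _ in IH *.
set u := \sum_(0 <= _ < _) _ in IH *.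
have t0 : 0 <= t by apply: sumr_ge0 => *; exact: sqr_ge0.
have u0 : 0 <= u by apply: sumr_ge0 => *; exact: sqr_ge0.
apply: (@le_trans _ _ (Num.sqrt t * Num.sqrt u + a n * b n)).
  by rewrite lerD2r.
rewrite -[leRHS]sqrtrM ?addr_ge0 ?sqr_ge0//; apply: le_trans (ler_norm _) _.
rewrite -sqrtr_sqr ler_wsqrtr//.
rewrite -[t in leRHS](sqr_sqrtr t0) -[u in leRHS](sqr_sqrtr u0).
(* Lagrange's identity in dimension two. *)
rewrite -subr_ge0 [leRHS](_ : _ = (Num.sqrt t * b n - Num.sqrt u * a n) ^+ 2).
  exact: sqr_ge0.
by ring.
Qed.

Lemma dot_terms_le (x y : ell2) n :
  \sum_(0 <= k < n) normc (x k * ((y k)^*)%C) <= l2norm x * l2norm y.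
Proof.
under eq_bigr do rewrite normcM normc_conj.
apply: le_trans (finite_cauchy_schwarz _ _ _) _.
by apply: ler_pM; rewrite ?sqrtr_ge0// sq_series_le_l2norm// ell2P.
Qed.

Lemma ell2_dot_cvg (x y : ell2) :
  [series x n * ((y n)^*)%C]_n @ \oo --> ell2_dot x y.
Proof. exact: (complex_series_bound (dot_terms_le x y)).1. Qed.

Lemma normc_ell2_dot (x y : ell2) : normc (ell2_dot x y) <= l2norm x * l2norm y.
Proof. exact: (complex_series_bound (dot_terms_le x y)).2. Qed.

Lemma ell2_dotDl (x y z : ell2) :
  ell2_dot (x + y) z = ell2_dot x z + ell2_dot y z.
Proof.
apply: complex_cvg_lim.
rewrite [X in X @ _ --> _](_ : _ =
  (fun m => [series x n * ((z n)^*)%C]_n m + [series y n * ((z n)^*)%C]_n m)).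
  by apply: complex_cvgD; exact: ell2_dot_cvg.
apply/funext => n; rewrite /series/= -big_split/=.
by apply: eq_bigr => k _; rewrite -mulrDl.
Qed.

Lemma ell2_dotZl (a : C) (x z : ell2) : ell2_dot (a *: x) z = a * ell2_dot x z.
Proof.
apply: complex_cvg_lim.
rewrite [X in X @ _ --> _](_ : _ =
  (fun m => a * [series x n * ((z n)^*)%C]_n m)).
  by apply: complex_cvgZ; exact: ell2_dot_cvg.
apply/funext => n; rewrite /series/= mulr_sumr.
by apply: eq_bigr => k _; rewrite mulrA.
Qed.

Lemma ell2_dotBl (x y z : ell2) :
  ell2_dot (x - y) z = ell2_dot x z - ell2_dot y z.
Proof. by rewrite ell2_dotDl -[- y]scaleN1r ell2_dotZl mulN1r. Qed.

Lemma ell2_dotDr (x y z : ell2) :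
  ell2_dot x (y + z) = ell2_dot x y + ell2_dot x z.
Proof.
apply: complex_cvg_lim.
rewrite [X in X @ _ --> _](_ : _ =
  (fun m => [series x n * ((y n)^*)%C]_n m + [series x n * ((z n)^*)%C]_n m)).
  by apply: complex_cvgD; exact: ell2_dot_cvg.
apply/funext => n; rewrite /series/= -big_split/=.
by apply: eq_bigr => k _; rewrite -mulrDr -rmorphD.
Qed.

Lemma ell2_dotZr (a : C) (x z : ell2) :
  ell2_dot x (a *: z) = (a^*)%C * ell2_dot x z.
Proof.
apply: complex_cvg_lim.
rewrite [X in X @ _ --> _](_ : _ =
  (fun m => (a^*)%C * [series x n * ((z n)^*)%C]_n m)).
  by apply: complex_cvgZ; exact: ell2_dot_cvg.
apply/funext => n; rewrite /series/= mulr_sumr.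
by apply: eq_bigr => k _; rewrite mulrCA -rmorphM.
Qed.

Lemma ell2_dot_basisr (x : ell2) i : ell2_dot x (ell2_basis R i) = x i.
Proof.
apply: complex_cvg_lim; apply: cvg_near_cst; exists i.+1 => // n /= ni.
rewrite /series/= big_mkord (bigD1 (Ordinal ni))//= eqxx conjc1 mulr1.
rewrite big1 ?addr0//.
move=> k; rewrite -val_eqE/= => /negPf ->.
by rewrite conjc0 mulr0.
Qed.

Lemma ell2_dot0r (x : ell2) : ell2_dot x 0 = 0.
Proof. by rewrite -(scale0r (0 : ell2)) ell2_dotZr conjc0 mul0r. Qed.

Lemma ell2_dot0l (x : ell2) : ell2_dot 0 x = 0.
Proof. by rewrite -(scale0r (0 : ell2)) ell2_dotZl mul0r. Qed.

Lemma cvg0_approx (u : nat -> R) : (forall n, 0 <= u n) ->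
  (forall e, 0 < e ->
    exists2 v : nat -> R, v @ \oo --> 0 & forall n, u n <= v n + e) ->
  u @ \oo --> 0.
Proof.
move=> u0 H; apply/cvgrPdist_lt => e e0.
have e2 : 0 < e / 2 by rewrite divr_gt0.
have [v /cvgrPdist_lt/(_ _ e2) v0 uv] := H _ e2.
apply: filterS v0 => n; rewrite !sub0r !normrN (ger0_norm (u0 n)) => vn.
rewrite (le_lt_trans (uv n))// [ltRHS]splitr ltrD2r.
exact: le_lt_trans (ler_norm _) vn.
Qed.

Lemma cvg0_sum (u : nat -> nat -> R) L : (forall k, u ^~ k @ \oo --> 0) ->
  (fun n => \sum_(0 <= k < L) u n k) @ \oo --> 0.
Proof.
move=> u0; elim: L => [|L IH].
  by under eq_fun do rewrite big_nil; exact: cvg_cst.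
under eq_fun do rewrite big_nat_recr//=.
have : (fun n => \sum_(0 <= k < L) u n k + u n L) @ \oo --> (0 + 0 : R).
  exact: cvgD IH (u0 L).
by rewrite addr0.
Qed.

(** Finite combinations of basis vectors are dense, and the common bound [M] makes the error of
    replacing [x] by a truncation uniform in [n]. *)
Lemma seminorms_cvg0 (F : nat -> ell2 -> R) (M : R) :
  (forall n x, 0 <= F n x) -> (forall n x y, F n (x + y) <= F n x + F n y) ->
  (forall n a x, F n (a *: x) <= normc a * F n x) ->
  (forall n x, F n x <= M * l2norm x) ->
  (forall j, (fun n => F n (ell2_basis R j)) @ \oo --> 0) ->
  forall x, (fun n => F n x) @ \oo --> 0.
Proof.
move=> F0 FD FZ FM Fe x; apply: cvg0_approx => // e e0.
(* [|M| + 1] replaces [M] so that division by it is safe. *)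
have M0 : 0 < `|M| + 1 by rewrite ltr_wpDl.
have eM : 0 < ((e / (`|M| + 1))%:C)%C by rewrite ltcR divr_gt0.
have /cvgrPdist_lt/(_ _ eM)[K _ /(_ K (leqnn K))] := @ell2_basis_expansion R x.
set xK := series _ K; rewrite /= ell2_normE ltcR => xKe.
exists (fun n => \sum_(0 <= k < K) normc (x k) * F n (ell2_basis R k)).
  apply: cvg0_sum => k; rewrite -(mulr0 (normc (x k))); exact: cvgMr.
move=> n; rewrite -{1}(subrK xK x) addrC (le_trans (FD _ _ _))// lerD//.
  rewrite /xK /series/=; elim/big_ind2 : _ => [|y a z b ya zb|k _] //.
    by rewrite -(scale0r (0 : ell2)) (le_trans (FZ _ _ _))// normc0 mul0r.
  exact: le_trans (FD _ _ _) (lerD ya zb).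
apply: le_trans (FM _ _) _.
apply: (@le_trans _ _ ((`|M| + 1) * l2norm (x - xK))).
  by rewrite ler_wpM2r ?l2norm_ge0// (le_trans (ler_norm _))// lerDl.
by rewrite mulrC -ler_pdivlMr// ltW.
Qed.

(** The density argument is run twice: in [x], reducing to basis vectors, and then in [y], where the
    pairings become matrix entries. *)
Lemma ell2_dot_cvg0 (D : nat -> B) (M : R) : 0 <= M ->
  (forall n x, l2norm (D n x) <= M * l2norm x) ->
  (forall i j, (fun n => normc (D n (ell2_basis R j) i)) @ \oo --> 0) ->
  forall x y, (fun n => normc (ell2_dot (D n x) y)) @ \oo --> 0.
Proof.
move=> M0 DM De x y.
apply: (@seminorms_cvg0 (fun n x => normc (ell2_dot (D n x) y))
  (M * l2norm y)) x.
- by move=> n x; exact: normc_ge0.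
- by move=> n x z; rewrite linearD ell2_dotDl le_normcD.
- by move=> n a x; rewrite linearZ ell2_dotZl normcM.
- move=> n x; apply: le_trans (normc_ell2_dot _ _) _.
  by rewrite mulrAC ler_wpM2r ?l2norm_ge0.
move=> j.
apply: (@seminorms_cvg0 (fun n y => normc (ell2_dot (D n (ell2_basis R j)) y))
  (M * l2norm (ell2_basis R j))) y.
- by move=> n y; exact: normc_ge0.
- by move=> n y z; rewrite ell2_dotDr le_normcD.
- by move=> n a y; rewrite ell2_dotZr normcM normc_conj.
- move=> n y; apply: le_trans (normc_ell2_dot _ _) _.
  by rewrite ler_wpM2r ?l2norm_ge0.
by move=> i; under eq_fun do rewrite ell2_dot_basisr; exact: De.
Qed.

Lemma wstar_index_summable (p : wstar_index R) :
  exists S : R, forall n,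
    \sum_(0 <= k < n) l2norm ((sval p).1 k) * l2norm ((sval p).2 k) <= S.
Proof.
case: p => -[xi eta] [/= cxi ceta].
exists (Num.sqrt (limn [series l2norm (xi k) ^+ 2]_k) *
  Num.sqrt (limn [series l2norm (eta k) ^+ 2]_k)).
move=> n; apply: le_trans (finite_cauchy_schwarz _ _ _) _.
have le (f : nat -> ell2) : square_summable f ->
    \sum_(0 <= k < n) l2norm (f k) ^+ 2 <= limn [series l2norm (f k) ^+ 2]_k.
  move=> cf; apply: (nondecreasing_cvgn_le _ cf n).
  by apply: nondecreasing_series => k _ _; exact: sqr_ge0.
by apply: ler_pM; rewrite ?sqrtr_ge0// ler_wsqrtr// le.
Qed.

Lemma wstar_terms_le (T : B) (p : wstar_index R) (M S : R) : 0 <= M ->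
  (forall x, l2norm (T x) <= M * l2norm x) ->
  (forall n,
    \sum_(0 <= k < n) l2norm ((sval p).1 k) * l2norm ((sval p).2 k) <= S) ->
  forall n,
    \sum_(0 <= k < n) normc (ell2_dot (T ((sval p).1 k)) ((sval p).2 k)) <= M * S.
Proof.
move=> M0 TM pS n; apply: (@le_trans _ _
  (M * \sum_(0 <= k < n) l2norm ((sval p).1 k) * l2norm ((sval p).2 k))).
  rewrite mulr_sumr; apply: ler_sum => k _.
  apply: le_trans (normc_ell2_dot _ _) _.
  by rewrite mulrA ler_wpM2r ?l2norm_ge0.
by rewrite ler_wpM2l.
Qed.

Lemma wstar_eval_cvg (T : B) (p : wstar_index R) :
  [series ell2_dot (T ((sval p).1 k)) ((sval p).2 k)]_k @ \oo --> wstar_eval T p.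
Proof.
have [M [M0 TM]] := bop_l2norm_bound T; have [S pS] := wstar_index_summable p.
exact: (complex_series_bound (wstar_terms_le M0 TM pS)).1.
Qed.

Lemma wstar_evalB (T U : B) (p : wstar_index R) :
  wstar_eval (T - U) p = wstar_eval T p - wstar_eval U p.
Proof.
apply: complex_cvg_lim; rewrite -[- wstar_eval U p]mulN1r.
rewrite [X in X @ _ --> _](_ : _ = (fun m =>
  [series ell2_dot (T ((sval p).1 k)) ((sval p).2 k)]_k m + -1 *
  [series ell2_dot (U ((sval p).1 k)) ((sval p).2 k)]_k m)).
  apply: complex_cvgD; first exact: wstar_eval_cvg.
  by apply: complex_cvgZ; exact: wstar_eval_cvg.
apply/funext => n; rewrite /series/= mulr_sumr -big_split/=.
by apply: eq_bigr => k _; rewrite mulN1r -ell2_dotBl.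
Qed.

(** Dominated convergence: the tail of the series is small uniformly in [n] by the norm bound, and
    the finite head tends to 0 term by term. *)
Lemma wstar_eval_cvg0 (D : nat -> B) (M : R) : 0 <= M ->
  (forall n x, l2norm (D n x) <= M * l2norm x) ->
  (forall i j, (fun n => normc (D n (ell2_basis R j) i)) @ \oo --> 0) ->
  forall p, (fun n => normc (wstar_eval (D n) p)) @ \oo --> 0.
Proof.
move=> M0 DM De p; apply: cvg0_approx => [n|e e0]; first exact: normc_ge0.
have [S pS] := wstar_index_summable p.
pose w k : R := l2norm ((sval p).1 k) * l2norm ((sval p).2 k).
have w0 k : 0 <= w k by rewrite mulr_ge0// l2norm_ge0.
have cw : cvgn (series w) by apply: nneg_series_cvg pS.
have M1 : 0 < M + 1 by rewrite ltr_wpDl.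
have eM : 0 < e / (M + 1) by rewrite divr_gt0.
have /cvgrPdist_lt/(_ _ eM)[L _ /(_ L (leqnn L)) /= wL] := cw.
pose d n k := normc (ell2_dot (D n ((sval p).1 k)) ((sval p).2 k)).
exists (fun n => \sum_(0 <= k < L) d n k).
  by apply: (cvg0_sum (u := d)) => k; exact: (ell2_dot_cvg0 M0 DM De).
move=> n; apply: (complex_series_bound _).2 => m.
(* Passing to [m + L] terms makes the splitting at [L] legitimate for every [m]. *)
apply: (@le_trans _ _ (\sum_(0 <= k < m + L) d n k)).
  rewrite [leRHS](@big_cat_nat _ _ _ m)//= ?leq_addr// lerDl.
  by apply: sumr_ge0 => k _; exact: normc_ge0.
rewrite (@big_cat_nat _ _ _ L)//= ?leq_addl// lerD2l.
apply: (@le_trans _ _ (M * \sum_(L <= k < m + L) w k)).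
  rewrite mulr_sumr; apply: ler_sum => k _.
  apply: le_trans (normc_ell2_dot _ _) _.
  by rewrite mulrA ler_wpM2r ?l2norm_ge0.
have -> : \sum_(L <= k < m + L) w k = series w (m + L) - series w L.
  rewrite /series/= [in RHS](@big_cat_nat _ _ _ L)//= ?leq_addl//.
  by rewrite addrAC subrr add0r.
apply: (@le_trans _ _ ((M + 1) * (limn (series w) - series w L))); last first.
  by rewrite mulrC -ler_pdivlMr// ltW// (le_lt_trans (ler_norm _) wL).
have ser : nondecreasing_seq (series w).
  by apply: nondecreasing_series => *; exact: w0.
have lel k := nondecreasing_cvgn_le ser cw k.
apply: ler_pM => //; rewrite ?lerDl// ?subr_ge0 ?ser ?leq_addl//.
by rewrite lerD2r.
Qed.

Lemma wstar_eval_cvg_entries (A : nat -> B) (T : B) (M : R) : 0 <= M ->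
  (forall n x, l2norm (A n x) <= M * l2norm x) ->
  (forall i j, (fun n => A n (ell2_basis R j) i) @ \oo --> T (ell2_basis R j) i) ->
  forall p, (fun n => wstar_eval (A n) p) @ \oo --> wstar_eval T p.
Proof.
move=> M0 AM Ae p; apply/complex_cvgP; under eq_fun do rewrite -wstar_evalB.
have [N [N0 TN]] := bop_l2norm_bound T.
apply: (@wstar_eval_cvg0 (fun n => T - A n) (N + M)); first exact: addr_ge0.
  move=> n x; rewrite mulrDl.
  apply: le_trans (_ : l2norm (T x) + l2norm (-1 *: A n x) <= _).
    by rewrite scaleN1r; exact: (ler_l2normD (T x) (- A n x)).
  rewrite lerD//; apply: le_trans (l2normZ_le _ _) _.
  by rewrite normcN normc1 mul1r.
by move=> i j; move/complex_cvgP : (Ae i j).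
Qed.

End Ell2Dot.

(** * Orbit-Toeplitz operators *)

Section OrbitToeplitz.
Variable R : realType.
Local Notation C := R[i].
Local Notation ell2 := (ell2 R).
Local Notation B := (bop ell2).
Local Notation e_ := (ell2_basis R).
Local Notation v := (ushift R).

Lemma bop_sumE (I : Type) (r : seq I) (P : pred I) (F : I -> B) (x : ell2) :
  (\sum_(i <- r | P i) F i) x = \sum_(i <- r | P i) F i x.
Proof. by elim/big_rec2 : _ => // i y T _ <-. Qed.

Lemma bop_scale (T : B) a x : T (a *: x) = a *: T x.
Proof. exact: linearZ. Qed.

Lemma bop_sub (T : B) x y : T (x - y) = T x - T y.
Proof. exact: linearB. Qed.

Lemma ushiftXE p (x : ell2) i :
  (v ^+ p) x i = if (p <= i)%N then x (i - p)%N else 0.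
Proof.
elim: p i => [|p IH] i; first by rewrite subn0.
by rewrite exprS [LHS]/=; case: i => [|i] //=; rewrite IH.
Qed.

Lemma ushiftX_basis p j : (v ^+ p) (e_ j) = e_ (j + p)%N.
Proof.
elim: p => [|p IH]; first by rewrite addn0.
by rewrite exprS -[LHS]/(v ((v ^+ p) (e_ j))) IH ushift_ell2_basis addnS.
Qed.

Lemma l2norm_ushiftX p (x : ell2) : l2norm ((v ^+ p) x) <= l2norm x.
Proof.
elim: p => [|p IH]; first exact: lexx.
rewrite exprS; apply: le_trans IH; exact: (ushift_seqP _).2.
Qed.

Lemma square_summable_single (x : ell2) :
  square_summable (fun k => if k is 0%N then x else 0).
Proof.
apply: (@nneg_series_cvg _ _ (l2norm x ^+ 2)) => [n|n]; first exact: sqr_ge0.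
case: n => [|n]; first by rewrite big_nil sqr_ge0.
rewrite big_nat_recl// big1 ?addr0// => k _.
by rewrite /= [l2norm _](l2norm0 R).2 expr0n.
Qed.

(** The index of a rank-one functional; at basis vectors it makes matrix entries w*-continuous. *)
Definition wstar_pair (x y : ell2) : wstar_index R :=
  exist _ (_, _) (conj (@square_summable_single x) (@square_summable_single y)).

Lemma wstar_eval_pair (T : B) x y :
  wstar_eval T (wstar_pair x y) = ell2_dot (T x) y.
Proof.
apply: complex_cvg_lim; apply: cvg_near_cst; exists 1%N => // -[//|n] _.
rewrite /series/= big_nat_recl// big1 ?addr0// => k _ /=.
exact: ell2_dot0r.
Qed.

Variables (K : topologicalType) (cK : compact [set: K]) (phi : K -> K) (t : K).

(* The second clause equates the n-th diagonal of T at j + p and at j, for    *)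
(* all n >= 0 at once.                                                        *)
Definition orbit_toeplitz : set B := [set T : B |
  (forall i j, (i < j)%N -> T (e_ j) i = 0) /\
  (forall j p, iter (j + p)%N phi t = iter j phi t ->
     T (e_ (j + p)%N) = (v ^+ p) (T (e_ j)))].

Lemma orbit_toeplitz_linear (S T : B) a :
  orbit_toeplitz S -> orbit_toeplitz T -> orbit_toeplitz (a *: S + T).
Proof.
move=> [S1 S2] [T1 T2]; split=> [i j ij|j p jp].
  by rewrite [LHS](_ : _ = a * S (e_ j) i + T (e_ j) i)// S1// T1// mulr0 addr0.
rewrite [RHS](_ : _ = (v ^+ p) (a *: S (e_ j) + T (e_ j)))// bopL.
by rewrite -S2// -T2.
Qed.

Lemma orbit_toeplitz0 : orbit_toeplitz 0.
Proof. by split=> // j p _; rewrite [RHS](_ : _ = (v ^+ p) 0)// linear0. Qed.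

Lemma orbit_rep_basis f j :
  orbit_rep cK phi t f (e_ j) = f (iter j phi t) *: e_ j.
Proof.
apply/val_inj/funext => n.
rewrite [LHS](_ : _ = f (iter n phi t) * (n == j)%:R)//.
rewrite [RHS](_ : _ = f (iter j phi t) * (n == j)%:R)//.
by have [->//|_] := eqVneq n j; rewrite !mulr0.
Qed.

Lemma orbit_toeplitz_monomial f n :
  orbit_toeplitz (v ^+ n * orbit_rep cK phi t f).
Proof.
have E j : (v ^+ n * orbit_rep cK phi t f) (e_ j) =
    f (iter j phi t) *: e_ (j + n)%N.
  rewrite -[LHS]/((v ^+ n) (orbit_rep cK phi t f (e_ j))).
  by rewrite orbit_rep_basis bop_scale ushiftX_basis.
split=> [i j ij|j p jp]; rewrite !E.
  rewrite [LHS](_ : _ = f (iter j phi t) * (i == j + n)%N%:R)//.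
  by rewrite ltn_eqF ?mulr0// ltn_addr.
by rewrite jp bop_scale ushiftX_basis addnAC.
Qed.

(** Monomials satisfy both clauses, which are linear; each clause, read entrywise, equates two
    w*-continuous functionals and so survives the closure. *)
Lemma semicrossed_sub_orbit_toeplitz :
  semicrossed_product cK phi t `<=` orbit_toeplitz.
Proof.
have poly T : analytic_polynomials cK phi t T -> orbit_toeplitz T.
  move=> [k [f ->]]; elim/big_ind : _ => [|S U oS oU|n _].
  - exact: orbit_toeplitz0.
  - by rewrite -[S]scale1r; exact: orbit_toeplitz_linear.
  exact: orbit_toeplitz_monomial.
have lsp T : lspan (analytic_polynomials cK phi t) T -> orbit_toeplitz T.
  move=> [k [a [A [PA ->]]]]; elim/big_rec : _ => [|n S _ oS].
    exact: orbit_toeplitz0.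
  exact: orbit_toeplitz_linear (poly _ (PA n)) oS.
move=> T sT; split=> [i j ij|j p jp].
  rewrite -(ell2_dot_basisr (T (e_ j))) -wstar_eval_pair.
  rewrite (wstar_closed_eval_eq (q := wstar_pair 0 0) _ sT).
    by rewrite wstar_eval_pair ell2_dot0r.
  move=> A /lsp[A1 _]; rewrite !wstar_eval_pair ell2_dot_basisr ell2_dot0r.
  exact: A1.
apply/val_inj/funext => i /=; rewrite ushiftXE.
(* The [i]-th entry of the shifted column is an entry of the original column, or 0 when [i < p]; [q]
   expresses both cases by one functional. *)
pose q := wstar_pair (e_ j) (if (p <= i)%N then e_ (i - p)%N else 0).
have qE (A : B) : wstar_eval A q = if (p <= i)%N then A (e_ j) (i - p)%N else 0.
  rewrite wstar_eval_pair; case: ifP => _; first exact: ell2_dot_basisr.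
  exact: ell2_dot0r.
rewrite -(ell2_dot_basisr (T _)) -wstar_eval_pair -qE.
apply: (wstar_closed_eval_eq _ sT) => A /lsp[_ A2].
by rewrite qE wstar_eval_pair ell2_dot_basisr A2// ushiftXE.
Qed.

(** * Geometric vectors and the reflexive hull *)

Lemma geometric_subproof (l : R) : 0 <= l <= 2^-1 ->
  (fun k => ((l ^+ k)%:C)%C) \in @sqsum R /\
  l2norm (fun k => ((l ^+ k)%:C)%C) <= 2.
Proof.
move=> /andP[l0 l2]; apply: sqsum_l2norm_bound => // n.
have -> : sq_series (fun k => ((l ^+ k)%:C)%C) n =
    \sum_(0 <= k < n) (l ^+ 2) ^+ k.
  apply: eq_bigr => k _ /=.
  by rewrite expr0n/= addr0 sqrtr_sqr ger0_norm ?exprn_ge0// -!exprM mulnC.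
(* The added term makes the bound inductive: since [l ^+ 2 <= 2^-1], the next value of
   [2 * (l ^+ 2) ^+ n] loses at least the power just added to the sum. *)
have H : \sum_(0 <= k < n) (l ^+ 2) ^+ k + 2 * (l ^+ 2) ^+ n <= 2.
  elim: n => [|n IH]; first by rewrite big_nil expr0; lra.
  rewrite big_nat_recr//= [X in 2 * X]exprS.
  have step (s q m : R) : 0 <= q -> m <= 2^-1 -> s + 2 * q <= 2 ->
      s + q + 2 * (m * q) <= 2.
    by nra.
  by apply: step IH; [rewrite exprn_ge0// exprn_ge0 | nra].
apply: (@le_trans _ _ 2); last by lra.
by apply: le_trans H; rewrite lerDl mulr_ge0// exprn_ge0// exprn_ge0.
Qed.

Definition geometric_vec (l : R) (hl : 0 <= l <= 2^-1) : ell2 :=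
  Ell2 (geometric_subproof hl).1.

(** The geometric vector is an eigenvector of the adjoint of the shift, with the real eigenvalue
    [l]. *)
Lemma ell2_dot_ushift_geometric l (hl : 0 <= l <= 2^-1) (x : ell2) :
  ell2_dot (v x) (geometric_vec hl) = (l%:C)%C * ell2_dot x (geometric_vec hl).
Proof.
apply: complex_cvg_lim; rewrite -cvg_shiftS.
rewrite [X in X @ _ --> _](_ : _ =
  (fun m => (l%:C)%C * [series x n * ((geometric_vec hl n)^*)%C]_n m)).
  by apply: complex_cvgZ; exact: ell2_dot_cvg.
apply/funext => n; rewrite /series/= big_nat_recl//= mul0r add0r mulr_sumr.
apply: eq_bigr => k _; rewrite mulrCA; congr (_ * _).
by rewrite exprS; simpc.
Qed.

Lemma ell2_dot_ushiftX_geometric l (hl : 0 <= l <= 2^-1) p (x : ell2) :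
  ell2_dot ((v ^+ p) x) (geometric_vec hl) =
  (l%:C)%C ^+ p * ell2_dot x (geometric_vec hl).
Proof.
elim: p => [|p IH]; first by rewrite expr0 mul1r.
rewrite exprS [LHS](_ : _ = ell2_dot (v ((v ^+ p) x)) (geometric_vec hl))//.
by rewrite ell2_dot_ushift_geometric IH exprS mulrA.
Qed.

Lemma bshift_subproof (x : ell2) : (fun k => x k.+1) \in @sqsum R.
Proof.
apply: (@sqsum_bound _ _ (limn (sq_series x)) _).1 => n.
apply: le_trans (sq_series_le (ell2P x) n.+1).
rewrite /sq_series /series/= [leRHS]big_nat_recl//= lerDr; exact: sqr_ge0.
Qed.

Definition bshift (x : ell2) : ell2 := Ell2 (bshift_subproof x).

Lemma ushift_bshift (x : ell2) : x = x 0%N *: e_ 0 + v (bshift x).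
Proof.
apply/val_inj/funext => -[|n].
  by rewrite [RHS](_ : _ = x 0%N * 1 + 0)// mulr1 addr0.
by rewrite [RHS](_ : _ = x 0%N * 0 + x n.+1)// mulr0 add0r.
Qed.

Lemma ell2_dot_basis0_geometric l (hl : 0 <= l <= 2^-1) :
  ell2_dot (e_ 0) (geometric_vec hl) = 1.
Proof.
apply: complex_cvg_lim; apply: cvg_near_cst; exists 1%N => // -[//|n] _.
rewrite /series/= big_nat_recl// big1 ?addr0 => [|k _ /=];
  last by rewrite mul0r.
by rewrite mul1r /= expr0 oppr0.
Qed.

(** Uniqueness of power series coefficients: letting [l] tend to 0 kills the constant term, the
    hypothesis then passes to the backward shift, and induction reaches every coefficient. *)
Lemma ell2_eq0_geometric (x : ell2) :
  (forall l (hl : 0 <= l <= 2^-1), 0 < l ->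
    ell2_dot x (geometric_vec hl) = 0) -> x = 0.
Proof.
suff H (z : ell2) :
    (forall l (hl : 0 <= l <= 2^-1), 0 < l ->
       ell2_dot z (geometric_vec hl) = 0) ->
    z 0%N = 0 /\ forall l (hl : 0 <= l <= 2^-1), 0 < l ->
       ell2_dot (bshift z) (geometric_vec hl) = 0.
  move=> xgeo; apply/val_inj/funext => n /=.
  elim: n x xgeo => [|n IH] x /H[x0 bx]; first exact: x0.
  exact: IH bx.
move=> zgeo.
have zE l (hl : 0 <= l <= 2^-1) : 0 < l ->
    z 0%N = - ((l%:C)%C * ell2_dot (bshift z) (geometric_vec hl)).
  move=> l0; have := zgeo l hl l0.
  rewrite {1}[z]ushift_bshift ell2_dotDl ell2_dotZl.
  rewrite ell2_dot_basis0_geometric mulr1.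
  by rewrite ell2_dot_ushift_geometric => /eqP; rewrite addr_eq0 => /eqP.
have z0 : z 0%N = 0.
  apply: eq0_normc; apply/eqP; rewrite eq_le normc_ge0 andbT.
  apply/ler_addgt0Pr => e e0; rewrite add0r.
  have b1 : 0 < 2 * l2norm (bshift z) + 1.
    by rewrite ltr_wpDl// mulr_ge0// l2norm_ge0.
  (* The factor 2 is the bound on the norms of the geometric vectors, uniform in [l]; adding 1 keeps
     the denominator positive. *)
  pose l := Num.min (2^-1) (e / (2 * l2norm (bshift z) + 1)).
  have l0 : 0 < l by rewrite lt_min divr_gt0// invr_gt0 ltr0n.
  have hl : 0 <= l <= 2^-1 by rewrite (ltW l0)/= ge_min lexx.
  rewrite (zE l hl l0) normcN normcM.
  have -> : normc (l%:C)%C = l by rewrite normc_real ger0_norm// ltW.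
  apply: (@le_trans _ _ (l * (2 * l2norm (bshift z) + 1))).
    rewrite ler_wpM2l// ?(ltW l0)//; apply: le_trans (normc_ell2_dot _ _) _.
    apply: (@le_trans _ _ (l2norm (bshift z) * 2)); last by rewrite mulrC lerDl.
    by rewrite ler_wpM2l ?l2norm_ge0// (geometric_subproof hl).2.
  by rewrite -ler_pdivlMr// ge_min lexx orbT.
(* With the constant term gone, the remaining product has the factor [l], which is cancelled because
   [l] is positive. *)
split=> // l hl l0; have := zE l hl l0; rewrite z0 => /esym/eqP.
rewrite oppr_eq0 mulf_eq0 => /orP[/eqP[l00]|/eqP//].
by rewrite l00 ltxx in l0.
Qed.

(** [T x] is a norm limit of vectors [A x], and pairing with [y] is continuous by Cauchy-Schwarz.
    Only relations tested on a single vector [x] pass to the hull in this way. *)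
Lemma Ref_dot0 (S : set B) (x y : ell2) :
  (forall A, S A -> ell2_dot (A x) y = 0) ->
  forall T, Ref S T -> ell2_dot (T x) y = 0.
Proof.
move=> S0 T /(_ x) ST; apply: eq0_normc.
apply/eqP; rewrite eq_le normc_ge0 andbT.
apply/ler_addgt0Pr => e e0; rewrite add0r.
have y1 : 0 < l2norm y + 1 by rewrite ltr_wpDl// l2norm_ge0.
have ey : 0 < ((e / (l2norm y + 1))%:C)%C by rewrite ltcR divr_gt0.
have [_ [[A SA <-]]] := ST _ (nbhsx_ballx (T x) _ ey).
rewrite -ball_normE/= ell2_normE ltcR => TA.
rewrite -[T x](subrK (A x)) ell2_dotDl S0// addr0.
apply: le_trans (normc_ell2_dot _ _) _.
apply: (@le_trans _ _ (l2norm (T x - A x) * (l2norm y + 1))).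
  by rewrite ler_wpM2l ?l2norm_ge0// lerDl.
by rewrite -ler_pdivlMr// ltW.
Qed.

Lemma Ref_semicrossed_sub_orbit_toeplitz :
  Ref (semicrossed_product cK phi t) `<=` orbit_toeplitz.
Proof.
move=> T rT; split=> [i j ij|j p jp].
  rewrite -(ell2_dot_basisr (T (e_ j))).
  apply: Ref_dot0 rT => A /semicrossed_sub_orbit_toeplitz[A1 _].
  by rewrite ell2_dot_basisr A1.
apply/subr0_eq/ell2_eq0_geometric => l hl l0.
(* The relation to be tested involves [A] at two vectors. Pairing with an eigenvector of the adjoint
   shift turns [v ^+ p] into the scalar [l ^+ p], which merges them into one vector independent of
   [A]. *)
have dotE (A : B) :
    ell2_dot (A (e_ (j + p)%N - (l%:C)%C ^+ p *: e_ j)) (geometric_vec hl) =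
    ell2_dot (A (e_ (j + p)%N) - (v ^+ p) (A (e_ j))) (geometric_vec hl).
  by rewrite bop_sub bop_scale !ell2_dotBl ell2_dotZl ell2_dot_ushiftX_geometric.
rewrite -dotE; apply: Ref_dot0 rT => A /semicrossed_sub_orbit_toeplitz[_ A2].
by rewrite dotE A2// subrr ell2_dot0l.
Qed.

End OrbitToeplitz.

(** * Diagonal operators and Tietze's theorem *)

Section Interpolation.
Variable R : realType.
Local Notation C := R[i].
Variable K : topologicalType.

Lemma continuous_complex (f g : K -> R) : continuous f -> continuous g ->
  continuous (fun s => Complex (f s) (g s) : C).
Proof.
move=> cf cg s; apply/(@cvgrPdist_lt C C K (nbhs s)) => -[e e'].
rewrite ltcE/= => /andP[/eqP -> e0].
have e2 : 0 < e / 2 by rewrite divr_gt0.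
have /cvgrPdist_lt/(_ _ e2) fs := cf s.
have /cvgrPdist_lt/(_ _ e2) gs := cg s.
near=> u.
rewrite normcE ltcR; apply: le_lt_trans (normc_le_ReIm _ _) _.
by rewrite [e]splitr ltrD//; near: u.
Unshelve. all: by end_near. Qed.

Hypotheses (cK : compact [set: K]) (hK : hausdorff_space K).

(** A finite subset of a Hausdorff space is closed and relatively discrete, so [g] is continuous on
    it; Tietze's theorem applies because compact Hausdorff spaces are normal. *)
Lemma finite_interpolation_real (A : set K) (g : K -> R) (M : R) :
  finite_set A -> 0 < M -> (forall x, A x -> `|g x| <= M) ->
  exists f : K -> R,
    [/\ continuous f, forall x, A x -> f x = g x & forall x, `|f x| <= M].
Proof.
move=> fA M0 gM; have T1 := hausdorff_accessible hK.
have /accessible_finite_set_closed clF := T1.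
have [|f [fg cf fM]] := continuous_bounded_extension (compact_normal hK cK)
  (clF _ fA) (f := g) M0 _ gM; last first.
  by exists f; split => // x Ax; rewrite fg// inE.
apply/subspace_continuousP => x Ax U /nbhs_singleton Ugx.
(* This neighbourhood meets [A] at most in [x]. *)
have : nbhs x (~` (A `\ x)).
  apply: open_nbhs_nbhs; split; last by move=> [_]; exact.
  by apply: closed_openC; apply: clF; exact: finite_setD.
apply: filterS => y /= nAy Ay.
by have [->//|yx] := pselect (y = x); exfalso; apply: nAy.
Qed.

(** The bound doubles because real and imaginary parts are extended separately. *)
Lemma finite_interpolation (A : set K) (g : K -> C) (M : R) :
  finite_set A -> 0 < M -> (forall x, A x -> normc (g x) <= M) ->
  exists f : continuousType K C,
    (forall x, A x -> f x = g x) /\ forall x, normc (f x) <= M *+ 2.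
Proof.
move=> fA M0 gM.
have [a [ca ag aM]] := finite_interpolation_real fA M0
  (fun x Ax => le_trans (Re_le_normc (g x)) (gM x Ax)).
have [b [cb bg bM]] := finite_interpolation_real fA M0
  (fun x Ax => le_trans (Im_le_normc (g x)) (gM x Ax)).
pose h s : C := Complex (a s) (b s).
exists (HB.pack_for (continuousType K C) h
  (@isContinuous.Build K C h (continuous_complex ca cb))); split => [x Ax|x] /=.
  by rewrite /h ag// bg//; case: (g x).
by apply: le_trans (normc_le_ReIm _ _) _; rewrite mulr2n lerD.
Qed.
End Interpolation.

(** * Polynomials in the shift with diagonal coefficients *)

Section DiagonalOperators.
Variable R : realType.
Local Notation C := R[i].
Local Notation ell2 := (ell2 R).
Local Notation B := (bop ell2).
Local Notation e_ := (ell2_basis R).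
Local Notation v := (ushift R).

Section Diag.
Variables (b : nat -> C) (M : R) (bM : forall n, normc (b n) <= M).

Lemma diag_seqP (x : ell2) : (fun n => b n * x n) \in @sqsum R /\
  l2norm (fun n => b n * x n) <= M * l2norm x.
Proof.
apply: l2norm_mul (ell2P x); last exact: bM.
exact: le_trans (normc_ge0 _) (bM 0%N).
Qed.

Lemma diag_subproof : (fun x => Ell2 (diag_seqP x).1) \in bounded_op.
Proof.
apply/bounded_opP; split=> [a x y|].
  apply/val_inj/funext => n; rewrite /= !fctE/= mulrDr; congr (_ + _).
  exact: mulrCA.
exists ((M%:C)%C); split=> [|x].
  by rewrite lecR; exact: le_trans (normc_ge0 _) (bM 0%N).
by rewrite !ell2_normE -rmorphM lecR; exact: (diag_seqP x).2.
Qed.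

Definition diag_op : B := Bop diag_subproof.

End Diag.

Lemma l2norm_shift_sum_le (k : nat) (x : ell2) (F : 'I_k -> B) (M : R) :
  (forall n y, l2norm (F n y) <= M * l2norm y) ->
  l2norm ((\sum_(n < k) v ^+ n * F n) x) <= (k%:R * M) * l2norm x.
Proof.
move=> FM.
rewrite bop_sumE -mulrA mulr_natl -[in leRHS](card_ord k) -sumr_const.
elim/big_ind2 : _ => [|y a z c ya zc|n _].
- by rewrite [l2norm _](l2norm0 R).2.
- exact: le_trans (ler_l2normD _ _) (lerD ya zc).
by apply: le_trans (FM n x); exact: l2norm_ushiftX.
Qed.

Variables (K : topologicalType) (cK : compact [set: K]) (hK : hausdorff_space K)
  (phi : K -> K) (t : K).

(** Constancy on the fibres of the orbit map makes each [b n] a function on the orbit. Continuous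
    functions matching it at the first [L] orbit points, bounded independently of [L], give analytic
    polynomials that converge w* as [L] grows. *)
Lemma diag_polynomial_semicrossed (k : nat) (b : nat -> nat -> C) (M : R)
    (bM : forall n m, normc (b n m) <= M) :
  (forall n m m', iter m phi t = iter m' phi t -> b n m = b n m') ->
  semicrossed_product cK phi t (\sum_(n < k.+1) v ^+ n * diag_op (bM n)).
Proof.
move=> bphi.
have M0 : 0 <= M := le_trans (normc_ge0 _) (bM 0%N 0%N).
have /choice[f fP] (nL : nat * nat) : exists f : continuousType K C,
    (forall m, (m < nL.2)%N -> f (iter m phi t) = b nL.1 m) /\
    forall s, normc (f s) <= (M + 1) *+ 2.
  case: nL => n L; pose A := [set iter m phi t | m in `I_L].
  (* Any index reaching [s] will do, by constancy on fibres; off the orbit the default index 0 is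
     harmless. *)
  pose g s := b n (xget 0%N [set m | iter m phi t = s]).
  have gE m : g (iter m phi t) = b n m.
    apply: bphi.
    have /(xgetPex 0%N) : exists m', iter m' phi t = iter m phi t by exists m.
    exact.
  have [|||f [fg fM]] := @finite_interpolation R K cK hK A g (M + 1).
  - exact/finite_image/finite_II.
  - by rewrite ltr_wpDl.
  - by move=> x _; apply: le_trans (bM _ _) _; rewrite lerDl.
  exists f; split=> // m mL; rewrite fg ?gE//; by exists m.
pose A L : B := \sum_(n < k.+1) v ^+ n * orbit_rep cK phi t (f (val n, L)).
apply: (@wstar_closure_cvg R _ A) => [L|].
  apply: subset_closure; exists 1%N, (fun=> 1), (fun=> A L); split.
    by move=> _; exists k, (fun n => f (val n, L)).
  by rewrite big_ord1 scale1r.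
apply: (@wstar_eval_cvg_entries R A _ (k.+1%:R * ((M + 1) *+ 2))).
- by rewrite mulr_ge0// mulrn_wge0// addr_ge0.
- move=> L x; apply: l2norm_shift_sum_le => n y.
  apply: (@l2norm_mul R (fun m => f (val n, L) (iter m phi t)) y
    _ _ _ (ell2P y)).2.
    by rewrite mulrn_wge0// addr_ge0.
  by move=> m; apply: (fP (val n, L)).2.
(* Column [j] sees only the orbit point of index [j], so it is exact as soon as [L > j]. *)
move=> i j; apply: cvg_near_cst; exists j.+1 => // L /= jL.
congr (ell2_val _ i); rewrite !bop_sumE; apply: eq_bigr => n _.
rewrite -[LHS]/((v ^+ n) (orbit_rep cK phi t (f (val n, L)) (e_ j))).
rewrite -[RHS]/((v ^+ n) (diag_op (bM n) (e_ j))); congr ((v ^+ n) _).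
apply/val_inj/funext => m.
rewrite [LHS](_ : _ = f (val n, L) (iter m phi t) * (m == j)%:R)//.
rewrite [RHS](_ : _ = b n m * (m == j)%:R)//.
have [->|_] := eqVneq m j; last by rewrite !mulr0.
by rewrite (fP (val n, L)).1.
Qed.

End DiagonalOperators.

(** * Cesaro means *)

Section Cesaro.
Variable R : realType.
Local Notation C := R[i].
Local Notation ell2 := (ell2 R).
Local Notation B := (bop ell2).
Local Notation e_ := (ell2_basis R).
Local Notation v := (ushift R).

Lemma sqr_l2norm (x : ell2) : l2norm x ^+ 2 = limn (sq_series x).
Proof.
rewrite sqr_sqrtr//.
exact: le_trans (sq_series_ge0 x 0) (sq_series_le (ell2P x) 0%N).
Qed.

Lemma ell2_sumE (I : Type) (r : seq I) (P : pred I) (F : I -> ell2) i :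
  (\sum_(j <- r | P j) F j) i = \sum_(j <- r | P j) F j i.
Proof. by elim/big_rec2 : _ => // j y z _ <-. Qed.

Lemma sum_basisE (x : nat -> C) (P : pred nat) n i :
  (\sum_(0 <= j < n | P j) x j *: e_ j) i = if (i < n)%N && P i then x i else 0.
Proof.
rewrite ell2_sumE; elim: n => [|n IH]; first by rewrite big_nil.
rewrite big_mkcond big_nat_recr//= -big_mkcond IH ltnS [in RHS]leq_eqVlt.
rewrite [X in _ + X](_ : _ = if P n then x n * (i == n)%:R else 0)//.
have [->|_] := eqVneq i n; first by rewrite ltnn/= mulr1 add0r.
by rewrite mulr0 if_same addr0.
Qed.

Lemma l2norm_sum_basis (x : nat -> C) (P : pred nat) n :
  l2norm (\sum_(0 <= j < n | P j) x j *: e_ j : ell2) ^+ 2 <=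
  \sum_(0 <= j < n | P j) normc (x j) ^+ 2.
Proof.
rewrite sqr_l2norm; apply: (sqsum_bound _).2 => m.
rewrite /sq_series /series/=.
under eq_bigr do rewrite sum_basisE.
rewrite (@big_nat_widen _ _ _ 0 n (n + m)) ?leq_addr//.
apply: (@le_trans _ _ (\sum_(0 <= i < n + m)
  normc (if (i < n)%N && P i then x i else 0) ^+ 2)).
  rewrite [leRHS](@big_cat_nat _ _ _ m)//= ?leq_addl// lerDl.
  by apply: sumr_ge0 => *; exact: sqr_ge0.
rewrite [leRHS]big_mkcond/=; apply: ler_sum => i _.
by rewrite andbC; case: ifP => // _; rewrite normc0 expr0n.
Qed.

(** Cauchy-Schwarz against the constant sequence 1. *)
Lemma sqr_sum_le (a : nat -> R) n :
  (\sum_(0 <= k < n) a k) ^+ 2 <= n%:R * \sum_(0 <= k < n) a k ^+ 2.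
Proof.
elim: n => [|n IH]; first by rewrite !big_nil expr0n mulr0.
rewrite !big_nat_recr//=.
have : (\sum_(0 <= k < n) a k) * a n *+ 2 <=
    \sum_(0 <= k < n) a k ^+ 2 + n%:R * a n ^+ 2.
  rewrite mulr_suml -mulr_natl mulr_sumr.
  have -> : n%:R * a n ^+ 2 = \sum_(0 <= k < n) a n ^+ 2.
    by rewrite sumr_const_nat subn0 mulr_natl.
  rewrite -big_split/=; apply: ler_sum => k _.
  by have := sqr_ge0 (a k - a n); nra.
rewrite sqrrD -natr1 -mulr_natl.
move: IH; set s := \sum_(0 <= k < n) a k.
set q := \sum_(0 <= k < n) _ ^+ 2; nra.
Qed.

Lemma sum_window_le (c : R) j N n : 0 <= c ->
  \sum_(0 <= s < n | (j <= s < j + N)%N) c <= N%:R * c.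
Proof.
move=> c0; rewrite big_const_seq iter_addr addr0 -[leLHS]mulr_natl.
rewrite ler_wpM2r// ler_nat.
rewrite -size_filter -[leqRHS](size_iota j N); apply: uniq_leq_size.
  by rewrite filter_uniq// iota_uniq.
by move=> s; rewrite mem_filter mem_iota => /andP[].
Qed.

Lemma big_nat_zero_tail (V : nmodType) (F : nat -> V) a b :
  (a <= b)%N ->
  (forall n, (a <= n)%N -> F n = 0) ->
  \sum_(0 <= n < b) F n = \sum_(0 <= n < a) F n.
Proof.
move=> ab F0; rewrite (@big_cat_nat _ _ _ a)//=.
rewrite [X in _ + X]big_nat [X in _ + X]big1 ?addr0//.
by move=> n /andP[an _]; exact: F0.
Qed.

(** The Fejer weight [1 - n / k.+1], cut off at 0 for [n > k] by truncated subtraction. *)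
Definition fejer k n : R := (k.+1 - n)%:R / k.+1%:R.

Lemma fejer01 k n : 0 <= fejer k n <= 1.
Proof.
by rewrite divr_ge0//= ler_pdivrMr ?ltr0n// mul1r ler_nat leq_subr.
Qed.

Lemma fejer_eq0 k n : (k < n)%N -> fejer k n = 0.
Proof. by move=> kn; rewrite /fejer (eqP kn) mul0r. Qed.

Lemma cvg_fejer n : (fun k => fejer k n) @ \oo --> (1 : R).
Proof.
have h : (fun k => n%:R * (k.+1%:R)^-1 : R) @ \oo --> (n%:R * 0 : R).
  by apply: cvgMr; exact: cvg_harmonic.
rewrite mulr0 in h; apply/subr_cvg0; apply/norm_cvg0P.
apply: cvg0_le h => k; rewrite normr_ge0/= distrC ger0_norm; last first.
  by rewrite subr_ge0; have /andP[] := fejer01 k n.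
rewrite lerBlDr -mulrDl ler_pdivlMr ?ltr0n// mul1r -natrD ler_nat; lia.
Qed.

Variables (K : topologicalType) (cK : compact [set: K]) (hK : hausdorff_space K)
  (phi : K -> K) (t : K).

Variables (T : B) (oT : orbit_toeplitz phi t T) (M : R).
Hypotheses (M0 : 0 <= M) (TM : forall x, l2norm (T x) <= M * l2norm x).

Definition cesaro_coef k n m : C := ((fejer k n)%:C)%C * T (e_ m) (m + n)%N.

Lemma cesaro_coef_le k n m : normc (cesaro_coef k n m) <= M.
Proof.
have /andP[f0 f1] := fejer01 k n.
rewrite normcM normc_real ger0_norm//.
apply: (@le_trans _ _ (1 * l2norm (T (e_ m)))).
  by apply: ler_pM => //; [exact: normc_ge0 | exact: normc_le_l2norm].
rewrite mul1r; apply: le_trans (TM _) _; rewrite ler_piMr//.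
rewrite -(@ler_pXn2r _ 2)// ?nnegrE ?l2norm_ge0//.
(* A basis vector is a one-term sum, so this bounds its norm by 1. *)
have := @l2norm_sum_basis (fun=> 1) (pred1 m) m.+1.
rewrite !big_nat1_eq /= ltnSn scale1r => h; apply: le_trans h _.
by rewrite expr0n addr0 expr1n sqrtr1.
Qed.

Definition cesaro k : B :=
  \sum_(n < k.+1) v ^+ n * diag_op (cesaro_coef_le k n).

Lemma cesaro_semicrossed k : semicrossed_product cK phi t (cesaro k).
Proof.
apply: (@diag_polynomial_semicrossed R K cK hK phi t k (cesaro_coef k)) => n.
(* Ordering the two indices brings the fibre condition to the form of the second clause of
   [orbit_toeplitz]. *)
suff H m p : iter (m + p)%N phi t = iter m phi t ->
    cesaro_coef k n (m + p)%N = cesaro_coef k n m.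
  move=> m m' E; have [mm|/ltnW mm] := leqP m m'.
    by rewrite -(subnKC mm) H// subnKC.
  by rewrite -(subnKC mm) H// subnKC.
move=> E; rewrite /cesaro_coef oT.2// ushiftXE addnAC leq_addl addnK //.
Qed.

Lemma cesaroE k x i : cesaro k x i =
  \sum_(0 <= j < i.+1) ((fejer k (i - j))%:C)%C * T (e_ j) i * x j.
Proof.
pose G n : C :=
  if (n <= i)%N then ((fejer k n)%:C)%C * T (e_ (i - n)%N) i * x (i - n)%N else 0.
transitivity (\sum_(0 <= n < k.+1) G n).
  rewrite /cesaro bop_sumE ell2_sumE big_mkord; apply: eq_bigr => n _.
  rewrite -[LHS]/((v ^+ n) (diag_op (cesaro_coef_le k n) x) i) ushiftXE /G.
  case: ifP => // ni.
  rewrite [LHS](_ : _ = cesaro_coef k n (i - n)%N * x (i - n)%N)//.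
  by rewrite /cesaro_coef subnK.
transitivity (\sum_(0 <= n < i.+1) G n).
  (* [G] vanishes beyond [k] by its weight and beyond [i] by definition, so both ranges are compared
     with a common longer one. *)
  rewrite -(@big_nat_zero_tail _ G k.+1 (k.+1 + i.+1)) ?leq_addr//; last first.
    by move=> n kn; rewrite /G fejer_eq0//; case: ifP => // _; rewrite !mul0r.
  rewrite (@big_nat_zero_tail _ G i.+1 (k.+1 + i.+1)) ?leq_addl// => n ni.
  by rewrite /G leqNgt ni.
rewrite big_nat_rev/= add0n; apply: eq_big_nat => j /andP[_ ji].
by rewrite /G subSS leq_subr subKn.
Qed.

Lemma cesaro_entry k i j :
  cesaro k (e_ j) i = ((fejer k (i - j))%:C)%C * T (e_ j) i.
Proof.
rewrite cesaroE; have [ij|ji] := ltnP i j.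
  rewrite oT.1// mulr0 big_nat big1// => n /andP[_ ni].
  by rewrite [e_ j n](_ : _ = (n == j)%:R)// ltn_eqF ?mulr0// (leq_trans ni).
rewrite big_mkord (bigD1 (Ordinal (ji : (j < i.+1)%N)))//= eqxx mulr1.
rewrite big1 ?addr0//.
move=> n; rewrite -val_eqE/= => /negPf ->.
by rewrite mulr0.
Qed.

(* With Q_s the projection onto the e_j such that j <= s < j + N, the Cesaro  *)
(* mean of order N = k + 1 is the average (1/N) sum_s Q_s T Q_s; Cauchy-      *)
(* Schwarz over the N windows that see a given coordinate bounds its norm.    *)
Definition window_proj N s (x : ell2) : ell2 :=
  \sum_(0 <= j < s.+1 | (s < j + N)%N) x j *: e_ j.

(** The windows containing [i] are those at [s = i + l] with [l <= k]. For [j <= i], exactly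
    [k.+1 - (i - j)] of them also contain [j], which is [k.+1] times the Fejer weight; columns
    [j > i] contribute nothing by triangularity. *)
Lemma cesaro_window k x i :
  k.+1%:R * cesaro k x i = \sum_(0 <= l < k.+1) T (window_proj k.+1 (i + l) x) i.
Proof.
pose H l j : C := if (i + l < j + k.+1)%N then x j * T (e_ j) i else 0.
transitivity (\sum_(0 <= l < k.+1) \sum_(0 <= j < i.+1) H l j); last first.
  apply: eq_bigr => l _.
  have -> : T (window_proj k.+1 (i + l) x) =
      \sum_(0 <= j < (i + l).+1 | (i + l < j + k.+1)%N) x j *: T (e_ j).
    rewrite /window_proj (raddf_sum T); apply: eq_bigr => j _; exact: bop_scale.
  rewrite ell2_sumE [RHS]big_mkcond/=.
  rewrite (@big_nat_zero_tail _ _ i.+1 (i + l).+1); first by [].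
    by rewrite ltnS leq_addr.
  move=> j ij; case: ifP => // _.
  by rewrite [LHS](_ : _ = x j * T (e_ j) i)// oT.1// mulr0.
rewrite exchange_big/= cesaroE mulr_sumr; apply: eq_big_nat => j /andP[_ ji].
rewrite /H -big_mkcond/=.
rewrite (eq_bigl (fun l => predT l && (l < k.+1 - (i - j))%N));
  last by move=> l /=; lia.
rewrite -(@big_nat_widen _ _ _ 0 _ k.+1 predT) ?leq_subr//.
rewrite sumr_const_nat subn0 -mulr_natl.
have -> : ((fejer k (i - j))%:C)%C = (k.+1 - (i - j))%:R / k.+1%:R :> C.
  by rewrite /fejer rmorphM fmorphV !rmorph_nat.
have k0 : k.+1%:R != 0 :> C by rewrite pnatr_eq0.
by field.
Qed.

Lemma l2norm_cesaro k x : l2norm (cesaro k x) <= M * l2norm x.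
Proof.
apply: (sqsum_l2norm_bound _ _).2; first by rewrite mulr_ge0// l2norm_ge0.
move=> m; set N := k.+1.
have N0 : 0 < N%:R :> R by rewrite ltr0n.
pose g s i : R := normc (T (window_proj N s x) i) ^+ 2.
have g0 s i : 0 <= g s i by exact: sqr_ge0.
(* Cauchy-Schwarz over the [N] windows containing [i] costs one factor [N]; for [i < m] they all
   have [s < m + N]. *)
have step1 : N%:R ^+ 2 * sq_series (cesaro k x) m <=
    N%:R * \sum_(0 <= s < m + N) \sum_(0 <= i < m) g s i.
  rewrite /sq_series /series/= mulr_sumr exchange_big/= mulr_sumr.
  rewrite big_nat [leRHS]big_nat; apply: ler_sum => i /andP[_ im].
  have -> : N%:R ^+ 2 * normc (cesaro k x i) ^+ 2 =
      normc (N%:R * cesaro k x i) ^+ 2.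
    rewrite normcM exprMn; congr (_ ^+ 2 * _).
    by rewrite -(rmorph_nat (real_complex R)) normc_real ger0_norm.
  rewrite cesaro_window.
  apply: (@le_trans _ _
    ((\sum_(0 <= l < N) normc (T (window_proj N (i + l) x) i)) ^+ 2)).
    rewrite ler_sqr ?nnegrE ?normc_ge0 ?sumr_ge0//;
      last by move=> *; exact: normc_ge0.
    elim/big_ind2 : _ => [|y a z c ya zc|n _] //; first by rewrite normc0.
    exact: le_trans (le_normcD _ _) (lerD ya zc).
  apply: le_trans (sqr_sum_le _ _) _; rewrite ler_wpM2l//.
  rewrite [leLHS](_ : _ = \sum_(i <= s < i + N) g s i); last first.
    have := @big_addn _ 0 +%R 0 (i + N) i predT (g ^~ i).
    rewrite add0n addKn => ->.
    by apply: eq_bigr => l _; rewrite addnC.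
  rewrite [leRHS](@big_cat_nat _ _ _ (i + N))//= ?leq_add2r 1?ltnW//.
  rewrite (@big_cat_nat _ _ _ i 0 (i + N))//= ?leq_addr//.
  by rewrite -addrA addrCA lerDl addr_ge0// sumr_ge0.
(* Each window contributes at most [M ^+ 2] times the squared norm of the projected vector.
   Exchanging sums, each coordinate of [x] is counted at most [N] times; this second factor [N]
   balances the square on the left of [step1]. *)
have step2 : \sum_(0 <= s < m + N) \sum_(0 <= i < m) g s i <=
    M ^+ 2 * (N%:R * l2norm x ^+ 2).
  apply: (@le_trans _ _ (M ^+ 2 * \sum_(0 <= s < m + N)
    \sum_(0 <= j < s.+1 | (s < j + N)%N) normc (x j) ^+ 2)).
    rewrite mulr_sumr; apply: ler_sum => s _.
    apply: le_trans (_ : l2norm (T (window_proj N s x)) ^+ 2 <= _).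
      rewrite sqr_l2norm; exact: (sq_series_le (ell2P (T (window_proj N s x)))).
    apply: (@le_trans _ _ ((M * l2norm (window_proj N s x)) ^+ 2)).
      by rewrite ler_sqr ?nnegrE ?mulr_ge0 ?l2norm_ge0.
    rewrite exprMn ler_wpM2l ?sqr_ge0//; exact: l2norm_sum_basis.
  rewrite ler_wpM2l ?sqr_ge0//.
  apply: (@le_trans _ _ (\sum_(0 <= j < m + N)
    \sum_(0 <= s < m + N | (j <= s < j + N)%N) normc (x j) ^+ 2)).
    under [leRHS]eq_bigr do rewrite big_mkcond/=.
    rewrite [leRHS]exchange_big/= big_nat [leRHS]big_nat.
    apply: ler_sum => s /andP[_ sm].
    rewrite (@big_nat_widen _ _ _ 0 s.+1 (m + N))// -big_mkcond/=.
    by rewrite (eq_bigl (fun j => (j <= s < j + N)%N))// => j; rewrite andbC ltnS.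
  apply: (@le_trans _ _ (\sum_(0 <= j < m + N) N%:R * normc (x j) ^+ 2)).
    by apply: ler_sum => j _; apply: sum_window_le; exact: sqr_ge0.
  by rewrite -mulr_sumr ler_wpM2l// sqr_l2norm; exact: (sq_series_le (ell2P x)).
rewrite -(@ler_pM2l _ (N%:R ^+ 2)) ?exprn_gt0//.
apply: le_trans step1 _; apply: le_trans (ler_wpM2l (ltW N0) step2) _.
by rewrite le_eqVlt; apply/orP; left; apply/eqP; ring.
Qed.

End Cesaro.

Lemma orbit_toeplitz_sub_semicrossed (R : realType) (K : topologicalType)
    (cK : compact [set: K]) (phi : K -> K) (t : K) : hausdorff_space K ->
  @orbit_toeplitz R K phi t `<=` semicrossed_product cK phi t.
Proof.
move=> hK T oT; have [M [M0 TM]] := bop_l2norm_bound T.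
apply: (wstar_closure_cvg (A := cesaro M0 TM)).
  by move=> k; exact: cesaro_semicrossed.
apply: (wstar_eval_cvg_entries M0) => [k x|i j].
  exact: (l2norm_cesaro oT M0 TM).
under eq_fun do rewrite (cesaro_entry oT) mulrC.
have f1 := real_complex_cvg (@cvg_fejer R (i - j)%N).
by have := complex_cvgZ (c := T (ell2_basis R j) i) f1; rewrite mulr1.
Qed.

Theorem theorem3p3 (R : realType) (K : topologicalType)
    (compactK : compact [set: K]) (hausdorffK : hausdorff_space K)
    (phi : K -> K) (continuous_phi : continuous phi) (t : K) :
  reflexive_space (@semicrossed_product R K compactK phi t).
Proof.
apply/seteqP; split=> [T sT xi|T /Ref_semicrossed_sub_orbit_toeplitz oT].
  by apply: subset_closure; exists T.
exact: orbit_toeplitz_sub_semicrossed.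
Qed.
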